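(* Let $\alpha,\beta\ge 0$ with $\alpha\neq\beta$. Let $X,Y$ be positive, independent, non-Dirac random variables and define $$U=Y\,\frac{1+\beta(X+Y)}{1+\alpha X+\beta Y}\quad\text{and}\quad V=X\,\frac{1+\alpha(X+Y)}{1+\alpha X+\beta Y}.$$ If $U$ and $V$ are independent, then there exist $a,b,c>0$ such that $$(X,Y)\sim\mathcal K_{\alpha}(a,b,c)\otimes\mathcal K_{\beta}(b,a,c),$$ and we then have $$(U,V)\sim\mathcal K_{\alpha}(b,a,c)\otimes\mathcal K_{\beta}(a,b,c).$$
   Context: For $\alpha\ge 0$, $a,c>0$ and $b\in\mathbb R$, the scaled Kummer distribution $\mathcal K_\alpha(a,b,c)$ is the probability distribution on $\mathbb R$ with density (with respect to Lebesgue measure) proportional to $\frac{x^{a-1}e^{-cx}}{(1+\alpha x)^b}\,I_{(0,\infty)}(x)$. The notation $(X,Y)\sim\mu\otimes\nu$ means that the joint law of $(X,Y)$ is the product measure $\mu\otimes\nu$, i.e. $X$ and $Y$ are independent with $X\sim\mu$ and $Y\sim\nu$. A random variable is non-Dirac if it is not almost surely constant. No existence of densities is assumed for $X$ and $Y$. *)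

(* Defs.v *)
From HB Require Import structures.
From mathcomp Require Import all_boot all_order all_algebra.
From mathcomp Require Import all_classical all_reals all_analysis.
From mathcomp Require Import measurable_realfun ring lra.
Set Implicit Arguments.
Unset Strict Implicit.
Unset Printing Implicit Defensive.

Import Order.TTheory GRing.Theory Num.Theory.
Import numFieldNormedType.Exports.

Local Open Scope classical_set_scope.
Local Open Scope ring_scope.

Section kummer.
Context {R : realType}.
Implicit Types alpha a b c x : R.
Local Notation leb := (@lebesgue_measure R).

Definition kummer_fun alpha a b c : R -> R :=
  (fun x => x `^ (a - 1) * expR (- c * x) / (1 + alpha * x) `^ b)
    \_ `]0, +oo[.

Definition kummer_mass alpha a b c : \bar R :=
  (\int[leb]_x (kummer_fun alpha a b c x)%:E)%E.

(* The normalizing constant is positive and finite for the admissible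
   parameters: see [kummer_mass_gt0] and [kummer_mass_lty]. *)
Definition kummer_pdf alpha a b c x : R :=
  kummer_fun alpha a b c x / fine (kummer_mass alpha a b c).

Definition kummer_prob alpha a b c (A : set R) : \bar R :=
  (\int[leb]_(x in A) (kummer_pdf alpha a b c x)%:E)%E.

Lemma kummer_funE alpha a b c x : 0 < x ->
  kummer_fun alpha a b c x =
  x `^ (a - 1) * expR (- c * x) / (1 + alpha * x) `^ b.
Proof. by move=> x0; rewrite /kummer_fun patchE ifT// inE/= in_itv/= x0. Qed.

Lemma kummer_fun_eq0 alpha a b c x : x <= 0 -> kummer_fun alpha a b c x = 0.
Proof.
move=> x0; rewrite /kummer_fun patchE ifF//; apply/negP.
by rewrite inE/= in_itv/= andbT ltNge x0.
Qed.

Lemma kummer_fun_ge0 alpha a b c x : 0 <= kummer_fun alpha a b c x.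
Proof.
have [x0|x0] := leP x 0; first by rewrite kummer_fun_eq0.
by rewrite kummer_funE// !mulr_ge0 ?powR_ge0 ?expR_ge0// invr_ge0 powR_ge0.
Qed.

Lemma measurable_kummer_fun alpha a b c :
  measurable_fun [set: R] (kummer_fun alpha a b c).
Proof.
apply/measurable_restrict => //; apply: measurable_funTS.
under eq_fun do rewrite -powRN.
apply: measurable_funM; first apply: measurable_funM.
- exact: measurable_powR.
- by apply: measurableT_comp => //; exact: measurable_funM.
- apply: (measurableT_comp (measurable_powR (- b))).
  by apply: measurable_funD => //; exact: measurable_funM.
Qed.

Let kummer_fun_bound alpha a b c : 0 <= alpha -> 0 < a -> 0 < c ->
  exists K : R * R, [/\ 0 <= K.1, 0 <= K.2 & forall x, kummer_fun alpha a b c x <=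
    K.1 * ((fun y => y `^ (a - 1)) \_ `]0, 1]) x +
    K.2 * exponential_pdf (c / 2) x].
Proof.
move=> al0 a0 c0.
pose C := `|b| * ln (1 + alpha).
pose M := `|a - 1| + `|b| + 1.
pose D := C - M * ln (c / (2 * M)).
have C0 : 0 <= C by rewrite mulr_ge0 // ln_ge0// lerDl.
have M0 : 0 < M by rewrite ltr_wpDl// addr_ge0.
exists (expR C, expR D / (c / 2)); split => /=.
- exact: expR_ge0.
- by rewrite divr_ge0 ?expR_ge0// ltW// divr_gt0.
move=> x; have e0 : 0 <= exponential_pdf (c / 2) x.
  by apply: exponential_pdf_ge0; rewrite divr_ge0// ltW.
have [x0|x0] := leP x 0.
  rewrite kummer_fun_eq0// addr_ge0//.
    rewrite mulr_ge0 ?expR_ge0//; apply: restrict_ge0 => y _; exact: powR_ge0.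
  by rewrite mulr_ge0// divr_ge0 ?expR_ge0// ltW// divr_gt0.
have ax0 : 0 < 1 + alpha * x by rewrite ltr_pwDl// mulr_ge0// ltW.
have lax : 0 <= ln (1 + alpha * x).
  by rewrite ln_ge0// lerDl mulr_ge0// ltW.
rewrite kummer_funE// -powRN [(1 + _) `^ _]/powR gt_eqF//.
have [x1|x1] := leP x 1.
  rewrite (@le_trans _ _ (expR C * x `^ (a - 1)))//.
    rewrite mulrC ler_pM ?mulr_ge0 ?powR_ge0 ?expR_ge0//.
      rewrite ler_expR (@le_trans _ _ (`|b| * ln (1 + alpha * x)))//.
        by rewrite ler_wpM2r// -normrN ler_norm.
      rewrite ler_wpM2l// ler_ln ?posrE//; last by rewrite ltr_pwDl.
      by rewrite lerD2l ler_piMr.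
    rewrite ler_piMr ?powR_ge0// -[leRHS]expR0 ler_expR mulNr oppr_le0.
    by rewrite mulr_ge0// ltW.
  rewrite patchE ifT; last by rewrite inE/= in_itv/= x0.
  by rewrite lerDl mulr_ge0// divr_ge0 ?expR_ge0// ltW// divr_gt0.
have lx0 : 0 <= ln x by rewrite ln_ge0// ltW.
rewrite (@le_trans _ _ (expR D * expR (- (c / 2) * x)))//; last first.
  rewrite exponential_pdfE ?(ltW x0)// mulrA divfK ?gt_eqF ?divr_gt0//.
  rewrite lerDr mulr_ge0 ?expR_ge0//.
  by apply: restrict_ge0 => y _; exact: powR_ge0.
rewrite /powR gt_eqF// -!expRD ler_expR.
have l1 : (a - 1) * ln x <= `|a - 1| * ln x by rewrite ler_wpM2r// ler_norm.
have l2 : - b * ln (1 + alpha * x) <= C + `|b| * ln x.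
  rewrite -mulrDr (@le_trans _ _ (`|b| * ln (1 + alpha * x)))//.
    by rewrite ler_wpM2r// -normrN ler_norm.
  rewrite ler_wpM2l// -lnM ?posrE ?ltr_pwDl// ler_ln ?posrE//; last first.
    by rewrite mulr_gt0// ltr_pwDl.
  by rewrite mulrDl mul1r lerD2r ltW.
have l3 : M * ln x <= c / 2 * x - M * ln (c / (2 * M)).
  rewrite lerBrDr -mulrDr -lnM ?posrE//; last by rewrite divr_gt0// mulr_gt0.
  have := @ln_sublinear R (x * (c / (2 * M))).
  rewrite !mulr_gt0 ?invr_gt0 ?mulr_gt0// => /(_ isT) /ltW.
  rewrite -(ler_pM2l M0) => /le_trans; apply.
  by rewrite le_eqVlt; apply/orP; left; apply/eqP; field; rewrite gt_eqF.
have : M * ln x = `|a - 1| * ln x + `|b| * ln x + ln x by rewrite /M; ring.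
rewrite /D; lra.
Qed.

Let integral_powR01 a : 0 < a ->
  (\int[leb]_x (((fun y : R => y `^ (a - 1)) \_ `]0, 1]) x)%:E < +oo)%E.
Proof.
move=> a0.
pose F (n : nat) : set R := `[n.+2%:R^-1, 1]%classic.
have FE : \bigcup_n F n = `]0, 1]%classic.
  apply/seteqP; split => x /=.
    move=> [n _]; rewrite /F/= !in_itv/= => /andP[h ->]; rewrite andbT.
    by rewrite (lt_le_trans _ h)// invr_gt0.
  rewrite in_itv/= => /andP[x0 x1].
  have [n nx] : exists n : nat, n.+2%:R^-1 <= x.
    exists (Num.truncn x^-1); rewrite -[leRHS]invrK lef_pV2 ?posrE ?invr_gt0//.
    rewrite (le_trans (ltW (truncnS_gt _)))// ler_nat//.
  by exists n => //; rewrite /F/= in_itv/= nx x1.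
have mp : measurable_fun [set: R] (fun y : R => (y `^ (a - 1))%:E).
  by apply/measurable_EFinP; exact: measurable_powR.
rewrite [ltLHS](_ : _ = \int[leb]_(x in `]0%R, 1%R]) (x `^ (a - 1))%:E)%E;
  last first.
  rewrite [RHS]integral_mkcond; apply: eq_integral => x _.
  by rewrite !patchE; case: ifP.
rewrite -FE.
apply: (@le_lt_trans _ _ (a^-1)%:E); last exact: ltry.
have cv : (\int[leb]_(x in F i) (x `^ (a - 1))%:E)%E @[i --> \oo] -->
  (\int[leb]_(x in \bigcup_i F i) (x `^ (a - 1))%:E)%E.
  apply: ge0_nondecreasing_set_cvg_integral.
  - move=> m n mn; rewrite subsetEset => x; rewrite /F/= !in_itv/=.
    move=> /andP[h ->]; rewrite andbT (le_trans _ h)//.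
    by rewrite lef_pV2 ?posrE// ler_nat !ltnS.
  - by move=> i; exact: measurable_itv.
  - by move=> i; exact: measurable_funTS.
  - by move=> i x _; rewrite lee_fin powR_ge0.
rewrite -(cvg_lim _ cv)//; apply: lime_le; first by apply/cvg_ex; eexists; exact: cv.
apply: nearW => n; rewrite /F.
set e := n.+2%:R^-1; have e0 : 0 < e by rewrite invr_gt0.
have e1 : e < 1 by rewrite invf_lt1// ltr1n.
have dF (x : R) : 0 < x -> derivable (fun y : R => y `^ a / a) x 1.
  move=> x0; apply: derivableM => //; apply: derivable_powR.
  by rewrite in_itv/= x0.
rewrite (@continuous_FTC2 R _ (fun x => x `^ a / a))//.
- rewrite -EFinB lee_fin powR1 div1r lerBlDr lerDl divr_ge0 ?powR_ge0//.
  exact: ltW.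
- apply: derivable_within_continuous => x; rewrite in_itv/= => /andP[ex _].
  by apply: derivable_powR; rewrite in_itv/= (lt_le_trans e0 ex).
- have cF (x : R) : 0 < x -> {for x, continuous (fun y : R => y `^ a / a)}.
    move=> x0; apply: differentiable_continuous; apply/derivable1_diffP.
    exact: dF.
  split.
  + by move=> x; rewrite in_itv/= => /andP[ex _]; apply: dF; exact: lt_trans ex.
  + by apply: cvg_at_right_filter; exact: cF.
  + by apply: cvg_at_left_filter; exact: cF.
- move=> x; rewrite in_itv/= => /andP[ex _].
  have x0 : 0 < x by exact: lt_trans ex.
  rewrite derive1Mr; last by apply: derivable_powR; rewrite in_itv/= x0.
  rewrite powR_derive1 ?in_itv/= ?x0//.
  by rewrite mulrAC divff ?mul1r// gt_eqF.
Qed.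

Lemma kummer_mass_lty alpha a b c : 0 <= alpha -> 0 < a -> 0 < c ->
  (kummer_mass alpha a b c < +oo)%E.
Proof.
move=> al0 a0 c0; have [[K1 K2]/= [K10 K20 H]] := kummer_fun_bound b al0 a0 c0.
have c20 : 0 < c / 2 by rewrite divr_gt0.
set p := (fun y : R => y `^ (a - 1)) \_ `]0, 1].
have p0 x : 0 <= p x by apply: restrict_ge0 => y _; exact: powR_ge0.
have mp : measurable_fun [set: R] (EFin \o p).
  apply/measurable_EFinP/measurable_restrict => //.
  by apply: measurable_funTS; exact: measurable_powR.
have me : measurable_fun [set: R] (EFin \o exponential_pdf (c / 2)).
  by apply/measurable_EFinP; exact: measurable_exponential_pdf.
have e0 x : 0 <= exponential_pdf (c / 2) x.
  by apply: exponential_pdf_ge0; exact: ltW.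
rewrite /kummer_mass; apply: (@le_lt_trans _ _ (\int[leb]_x
   (K1%:E * (p x)%:E + K2%:E * (exponential_pdf (c / 2) x)%:E))%E).
  apply: ge0_le_integral => //=.
  - by move=> x _; rewrite lee_fin kummer_fun_ge0.
  - by apply/measurable_EFinP; exact: measurable_kummer_fun.
  - by apply: emeasurable_funD; apply: measurable_funeM.
  - by move=> x _; rewrite -!EFinM -EFinD lee_fin H.
rewrite ge0_integralD//; first last.
- by apply: measurable_funeM.
- by move=> x _; rewrite -EFinM lee_fin mulr_ge0.
- by apply: measurable_funeM.
- by move=> x _; rewrite -EFinM lee_fin mulr_ge0.
rewrite !ge0_integralZl_EFin//; try by move=> x _; rewrite lee_fin.
rewrite integral_exponential_pdf// lte_add_pinfty//.
- by apply: lte_mul_pinfty => //; exact: integral_powR01.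
- by rewrite mule1 ltry.
Qed.

Lemma kummer_mass_gt0 alpha a b c : 0 <= alpha -> (0 < kummer_mass alpha a b c)%E.
Proof.
move=> al0; rewrite lt_neqAle; apply/andP; split; last first.
  by apply: integral_ge0 => x _; rewrite lee_fin kummer_fun_ge0.
apply/negP => /eqP/esym h.
have mk : measurable_fun [set: R] (EFin \o kummer_fun alpha a b c).
  by apply/measurable_EFinP; exact: measurable_kummer_fun.
have : ae_eq leb setT (EFin \o kummer_fun alpha a b c) (cst 0%E).
  apply/(ae_eq_integral_abs leb measurableT mk); rewrite -[RHS]h.
  by apply: eq_integral => x _; rewrite gee0_abs// lee_fin kummer_fun_ge0.
move=> [N [mN N0 sN]].
have : (leb `]0%R, 1%R] <= leb N)%E.
  apply: le_measure; rewrite ?inE//=.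
  move=> x; rewrite /= in_itv/= => /andP[x0 _]; apply: sN => /= /(_ I)[].
  apply/eqP; rewrite gt_eqF// kummer_funE// divr_gt0 ?mulr_gt0 ?powR_gt0//.
    exact: expR_gt0.
  by rewrite ltr_pwDl// mulr_ge0// ltW.
by rewrite N0 lebesgue_measure_itv/= lte_fin ltr01 sube0 lee_fin ler10.
Qed.

Lemma kummer_pdf_ge0 alpha a b c x : 0 <= kummer_pdf alpha a b c x.
Proof.
rewrite divr_ge0 ?kummer_fun_ge0// fine_ge0//.
by apply: integral_ge0 => y _; rewrite lee_fin kummer_fun_ge0.
Qed.

Lemma measurable_kummer_pdf alpha a b c :
  measurable_fun [set: R] (kummer_pdf alpha a b c).
Proof. by apply: measurable_funM => //; exact: measurable_kummer_fun. Qed.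

End kummer.

Section kummer_probability.
Context {R : realType}.
Variables alpha a b c : R.
Hypotheses (alpha0 : 0 <= alpha) (a0 : 0 < a) (c0 : 0 < c).
Local Notation kummer := (kummer_prob alpha a b c).

Let kummer0 : kummer set0 = 0%E.
Proof. by rewrite /kummer_prob integral_set0. Qed.

Let kummer_ge0 A : (0 <= kummer A)%E.
Proof. by apply: integral_ge0 => x _; rewrite lee_fin kummer_pdf_ge0. Qed.

Let kummer_sigma_additive : semi_sigma_additive kummer.
Proof.
move=> /= F mF tF mUF; rewrite /kummer_prob; apply: cvg_toP.
  apply: ereal_nondecreasing_is_cvgn => m n mn.
  apply: lee_sum_nneg_natr => // k _ _; exact: kummer_ge0.
rewrite ge0_integral_bigcup//=.
- apply/measurable_funTS/measurable_EFinP; exact: measurable_kummer_pdf.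
- by move=> x _; rewrite lee_fin kummer_pdf_ge0.
Qed.

HB.instance Definition _ := isMeasure.Build _ _ _
  kummer kummer0 kummer_ge0 kummer_sigma_additive.

Lemma kummer_prob_setT : kummer [set: R] = 1%E.
Proof.
have Zgt0 := kummer_mass_gt0 a b c alpha0.
have Zfin : kummer_mass alpha a b c \is a fin_num.
  by rewrite ge0_fin_numE ?(ltW Zgt0)// kummer_mass_lty.
rewrite /kummer_prob; under eq_integral do rewrite /kummer_pdf mulrC EFinM.
rewrite ge0_integralZl_EFin//.
- rewrite -/(kummer_mass alpha a b c) -[X in (_ * X)%E](fineK Zfin) -EFinM.
  by rewrite mulVf// fine_eq0// gt_eqF.
- by move=> x _; rewrite lee_fin kummer_fun_ge0.
- by apply/measurable_EFinP; exact: measurable_kummer_fun.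
- by rewrite invr_ge0 fine_ge0// ltW.
Qed.

HB.instance Definition _ :=
  @Measure_isProbability.Build _ _ R kummer kummer_prob_setT.

End kummer_probability.

Section random_variables.
Context d (T : measurableType d) (R : realType) (P : probability T R).

Definition independent_rv (X Y : T -> R) : Prop :=
  forall A B : set R, measurable A -> measurable B ->
    P (X @^-1` A `&` Y @^-1` B) = (P (X @^-1` A) * P (Y @^-1` B))%E.

Definition dirac_rv (X : T -> R) : Prop := exists k : R, \forall t \ae P, X t = k.

Definition has_joint_law (X Y : T -> R) (m : set (R * R) -> \bar R) : Prop :=
  forall A : set (R * R), measurable A ->
    pushforward P (fun t => (X t, Y t)) A = m A.

End random_variables.

(* Main.v *)
Require Import Defs.
From HB Require Import structures.
From mathcomp Require Import all_boot all_order all_algebra.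
From mathcomp Require Import all_classical all_reals all_analysis.
From mathcomp Require Import measurable_realfun ring lra.
Import Order.TTheory GRing.Theory Num.Theory.
Import numFieldNormedType.Exports.
Set Implicit Arguments.
Unset Strict Implicit.
Unset Printing Implicit Defensive.
Local Open Scope classical_set_scope.
Local Open Scope ring_scope.

(** The map [(X, Y) |-> (U, V)] has three invariants: [U + V = X + Y],
    [V / (1 + alpha U) = X / (1 + beta Y)] and
    [U / (1 + beta V) = Y / (1 + alpha X)].  For natural numbers [p] and [q] put
    [a p q = E (X^p (1 + alpha X)^-q e^-X)],
    [b p q = E (Y^q (1 + beta Y)^-p e^-Y)],
    [c p q = E (V^p (1 + beta V)^-q e^-V)] and
    [d p q = E (U^q (1 + alpha U)^-p e^-U)].
    These moments exist for all positive variables.  By the invariants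
    ([tilted_weight_uv]) and the two independence assumptions, [a b = c d];
    multiplying the weights by [X + Y = U + V] gives a second relation, and each
    array satisfies a trivial linear relation that comes from
    [1 = (1 + alpha X) / (1 + alpha X)].  Since [Y - U] has the constant sign of
    [alpha - beta], the system is not degenerate, and its variables separate:
    [a p.+1 q = k p * a p q - alpha * h q * a p.+1 q.+1], and likewise for the
    other arrays, with positive [k] and [h] of one index each ([factorization]).
    Compatibility of the relations makes [k] and [h] affine with a common slope
    ([shared_slope]).  The slope is not zero, because otherwise the law of Y
    would be concentrated on the root of an injective function
    ([dirac_of_stationary]).  So [k p = (A + p) / C] and [h q = (B + q) / C],
    and these are exactly the contiguity relations of the Kummer integrals with
    parameters [A], [B] and [C] ([kummer_massR_parts]).

    It remains to see that the relations characterize the law.  They form a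
    linear recursion with a space of solutions of dimension at most two.  The Casoratian
    of two solutions varies polynomially along the diagonal [p = q], but for
    moment arrays it decays faster than any power; so it vanishes, and the
    moments are proportional to those of the Kummer density
    ([contiguous_proportional]).  Thanks to the factor [e^-X] the moments
    determine the measure ([moment_determinacy]).  Removing that factor replaces
    [C] by [C - 1], and the densities found for X and for Y can both be
    integrable only if [C - 1 > 0] ([kummer_mass_pinfty]).  *)

(** * Separation of variables for four coupled positive arrays *)

Section lattice.
Context {R : realType}.
Implicit Types (g : R) (k h : nat -> R).

(** The two relations let one compute [d p.+1 q.+2] in two ways, through the
    corner [(p, q)] and through the corner [(p.+1, q)]. *)
Lemma shared_slope g (d : nat -> nat -> R) k h : g != 0 ->
  (forall p q, d p q != 0) ->
  (forall p q, d p q = d p.+1 q + g * d p.+1 q.+1) ->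
  (forall p q, d p q.+1 = h q * d p q - g * k p * d p.+1 q.+1) ->
  forall p q, h q.+1 - h q = k p.+1 - k p.
Proof.
move=> g0 d0 e1 e2 p q.
have E1 := e1 p q; have E2 := e1 p q.+1; have E4 := e1 p.+1 q.+1.
have F1 := e2 p q; have F2 := e2 p.+1 q; have F3 := e2 p.+1 q.+1.
have : g * d p.+1 q.+1 * ((h q.+1 - h q) - (k p.+1 - k p)) = 0.
  (* the difference of the two computations, as a combination of relations *)
  have -> : g * d p.+1 q.+1 * ((h q.+1 - h q) - (k p.+1 - k p)) =
    (d p q.+1 - (h q * d p q - g * k p * d p.+1 q.+1))
    - (d p q.+1 - (d p.+1 q.+1 + g * d p.+1 q.+2))
    + h q * (d p q - (d p.+1 q + g * d p.+1 q.+1))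
    - (g * (d p.+1 q.+2 - (h q.+1 * d p.+1 q.+1 - g * k p.+1 * d p.+2 q.+2))
       + g * k p.+1 * (d p.+1 q.+1 - (d p.+2 q.+1 + g * d p.+2 q.+2))
       + (d p.+1 q.+1 - (h q * d p.+1 q - g * k p.+1 * d p.+2 q.+1))) by ring.
  by rewrite -E1 -E2 -E4 -F1 -F2 -F3 !subrr; ring.
by move/eqP; rewrite !mulf_eq0 (negPf g0) (negPf (d0 _ _))/= subr_eq0 => /eqP.
Qed.

Lemma affine_of_slope (u : nat -> R) s :
  (forall n, u n.+1 - u n = s) -> forall n, u n = u 0 + s * n%:R.
Proof.
move=> us; elim=> [|n IH]; first by rewrite mulr0 addr0.
by rewrite -[LHS](subrK (u n)) us IH -natr1; ring.
Qed.

(** The arrays [a, b, c, d] are to be thought of as the moments of X, Y, V, U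
    for the weights attached to the exponents [p] and [q].  Let [rho = a / d],
    which is also [c / b].  Writing [aE], [cE] and [abcd_sum] in terms of
    [rho], [b] and [d] gives two linear relations between
    [N = d01 b - b01 d] and [M = d10 b - b10 d], where 1 marks a shifted
    index; as [N] does not vanish, they are compatible only if
    [rho10 rho01 = rho rho11].  Hence [rho] is a product of a function of [p]
    and a function of [q], so the ratios of its neighbouring values depend on
    one index only, and the relations become a linear system with separated
    coefficients. *)
Section factorization.
Variables (al be : R) (a b c d : nat -> nat -> R).
Hypotheses (a_gt0 : forall p q, 0 < a p q) (d_gt0 : forall p q, 0 < d p q).
Hypothesis aE : forall p q, a p q = a p q.+1 + al * a p.+1 q.+1.
Hypothesis bE : forall p q, b p q = b p.+1 q + be * b p.+1 q.+1.
Hypothesis cE : forall p q, c p q = c p q.+1 + be * c p.+1 q.+1.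
Hypothesis dE : forall p q, d p q = d p.+1 q + al * d p.+1 q.+1.
Hypothesis abcd : forall p q, a p q * b p q = c p q * d p q.
Hypothesis abcd_sum : forall p q,
  a p.+1 q * b p q + a p q * b p q.+1 = c p.+1 q * d p q + c p q * d p q.+1.
Hypothesis bd_neq : forall p q, b p q.+1 * d p q != d p q.+1 * b p q.

Let rho p q := a p q / d p q.
Let rho_gt0 p q : 0 < rho p q. Proof. by rewrite divr_gt0. Qed.
Let rho_neq0 p q : rho p q != 0. Proof. by rewrite gt_eqF. Qed.
Let a_rho p q : a p q = rho p q * d p q.
Proof. by rewrite divfK// gt_eqF. Qed.
Let c_rho p q : c p q = rho p q * b p q.
Proof.
apply: (mulIf (lt0r_neq0 (d_gt0 p q))).
by rewrite -abcd a_rho; ring.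
Qed.

Let rho_mul p q : rho p.+1 q * rho p q.+1 = rho p q * rho p.+1 q.+1.
Proof.
set N := d p q.+1 * b p q - b p q.+1 * d p q.
set M := d p.+1 q * b p q - b p.+1 q * d p q.
have N0 : N != 0 by rewrite subr_eq0 eq_sym bd_neq.
have e1 : rho p.+1 q * M = rho p q * N.
  have := abcd_sum p q; rewrite !a_rho !c_rho => e.
  apply/eqP; rewrite -subr_eq0 /M /N; apply/eqP.
  by move/eqP: e; rewrite -subr_eq0 => /eqP <-; ring.
have e2 : rho p q.+1 * N = rho p.+1 q.+1 * M.
  have ea : rho p q * d p q =
      rho p q.+1 * d p q.+1 + rho p.+1 q.+1 * (d p q - d p.+1 q).
    by rewrite -a_rho aE !a_rho (dE p q); ring.
  have ec : rho p q * b p q =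
      rho p q.+1 * b p q.+1 + rho p.+1 q.+1 * (b p q - b p.+1 q).
    by rewrite -c_rho cE !c_rho (bE p q); ring.
  apply/eqP; rewrite -subr_eq0; apply/eqP.
  transitivity (b p q * (rho p q * d p q) - d p q * (rho p q * b p q)).
    by rewrite {1}ea {1}ec /M /N; ring.
  by ring.
apply: (mulIf N0); rewrite -mulrA e2 mulrCA e1; ring.
Qed.

Let k p := rho p.+1 0 / rho p 0.
Let h q := rho 0 q / rho 0 q.+1.

Let rho1 p q : rho p.+1 q = k p * rho p q.
Proof.
elim: q => [|q IH]; first by rewrite divfK.
apply: (mulfI (rho_neq0 p q)); rewrite -rho_mul IH; ring.
Qed.

Let rho2 p q : rho p q = h q * rho p q.+1.
Proof.
elim: p => [|p IH]; first by rewrite divfK.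
apply: (mulfI (rho_neq0 p q.+1)).
by rewrite mulrC rho_mul {1}IH; ring.
Qed.

Lemma factorization : exists k h : nat -> R,
  [/\ (forall p, 0 < k p) /\ (forall q, 0 < h q),
      forall p q, a p.+1 q = k p * a p q - al * h q * a p.+1 q.+1,
      forall p q, b p q.+1 = h q * b p q - be * k p * b p.+1 q.+1,
      forall p q, c p.+1 q = k p * c p q - be * h q * c p.+1 q.+1 &
      forall p q, d p q.+1 = h q * d p q - al * k p * d p.+1 q.+1].
Proof.
exists k, h; split; first by split=> n; rewrite divr_gt0.
- by move=> p q; rewrite !a_rho !rho1 (rho2 p q) (dE p q); ring.
- move=> p q; apply: (mulfI (rho_neq0 p q.+1)).
  have := cE p q; rewrite !c_rho (rho2 p q) rho1 => e.
  transitivity (h q * rho p q.+1 * b p q -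
      be * (k p * rho p q.+1 * b p.+1 q.+1)); last by ring.
  by rewrite e; ring.
- by move=> p q; rewrite !c_rho !rho1 (rho2 p q) (bE p q); ring.
- move=> p q; apply: (mulfI (rho_neq0 p q.+1)).
  have := aE p q; rewrite !a_rho (rho2 p q) rho1 => e.
  transitivity (h q * rho p q.+1 * d p q -
      al * (k p * rho p q.+1 * d p.+1 q.+1)); last by ring.
  by rewrite e; ring.
Qed.
End factorization.

Lemma pos_affine_slope (u : nat -> R) s :
  (forall n, 0 < u n) -> (forall n, u n = u 0 + s * n%:R) -> 0 <= s.
Proof.
move=> u0 us; rewrite leNgt; apply/negP => s0.
have := u0 (Num.truncn (u 0 / - s)).+1; rewrite us ltNge => /negP; apply.
rewrite -lerBrDr sub0r -mulNr mulrC -ler_pdivrMr ?oppr_gt0//.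
by rewrite ltW// truncnS_gt.
Qed.
End lattice.

(** * Bernoulli inequalities and a polynomial threshold *)

Section threshold.
Context {R : realType}.
Implicit Types x y z : R.

Lemma bernoulli_ge z n : 0 <= z -> 1 + n%:R * z <= (1 + z) ^+ n.
Proof.
move=> z0; elim: n => [|n IH]; first by rewrite mul0r addr0 expr0.
rewrite exprS; apply: (le_trans _ (ler_wpM2l _ IH)); last by rewrite addr_ge0.
have : 0 <= n%:R * z * z by rewrite !mulr_ge0.
by rewrite -natr1; lra.
Qed.

Lemma bernoulli_le z n : 0 <= z <= 1 -> 1 - n%:R * z <= (1 - z) ^+ n.
Proof.
move=> /andP[z0 z1]; elim: n => [|n IH]; first by rewrite mul0r subr0 expr0.
rewrite exprS; apply: (le_trans _ (ler_wpM2l _ IH)); last by rewrite subr_ge0.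
have : 0 <= n%:R * z * z by rewrite !mulr_ge0.
by rewrite -natr1; lra.
Qed.

Lemma cvg_natX0 y : 0 <= y < 1 -> n%:R * y ^+ n @[n --> \oo] --> (0 : R).
Proof.
move=> /andP[y0 y1].
have [->|yn0] := eqVneq y 0.
  rewrite (_ : (fun n => _) = (fun=> 0)); first exact: cvg_cst.
  by apply/funext => -[|n]; rewrite ?mul0r// expr0n mulr0.
have yp : 0 < y by rewrite lt_neqAle eq_sym yn0.
pose theta := - ln y.
have th0 : 0 < theta by rewrite oppr_gt0 ln_lt0// yp.
have yE n : y ^+ n = expR (- (n%:R * theta)).
  by rewrite /theta mulrN opprK mulrC expRM_natr lnK.
have H : (2 / theta ^+ 2) * n.+1%:R^-1 @[n --> \oo] --> (2 / theta ^+ 2) * (0 : R).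
  by apply: cvgMr; exact: cvg_harmonic.
rewrite mulr0 in H.
rewrite -(cvg_shiftS (fun n => n%:R * y ^+ n)).
apply: (squeeze_cvgr _ (cvg_cst (0 : R)) H).
near=> n; rewrite mulr_ge0 ?exprn_ge0//= yE.
have nth : 0 < n.+1%:R * theta by rewrite mulr_gt0.
rewrite expRN ler_pdivrMr ?expR_gt0//.
apply: le_trans (ler_wpM2l _ (expR_ge1Dxn 1 (ltW nth))).
  rewrite mulrDr mulr1 ler_wpDl//.
    by rewrite mulr_ge0 ?invr_ge0// divr_ge0// exprn_ge0// ltW.
  rewrite le_eqVlt; apply/orP; left; apply/eqP; rewrite exprMn.
  by rewrite /factorial/=; field; rewrite ?gt_eqF// ?ltr0n.
by rewrite mulr_ge0 ?invr_ge0// divr_ge0// exprn_ge0// ltW.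
Unshelve. all: end_near. Qed.

(** Powers [(1 - z ^+ n) ^+ m] tend to a step function of [z] when [m] is of
    order [2 ^ n]; the extra factor [n] in the exponent makes the limit 0 also
    at the jump [z = 1 / 2], so that no atom has to be discussed later. *)
Lemma threshold_lt z : 0 <= z < 2^-1 ->
  (1 - z ^+ n) ^+ (n * 2 ^ n) @[n --> \oo] --> (1 : R).
Proof.
move=> /andP[z0 z1].
have H : 1 - n%:R * (2 * z) ^+ n @[n --> \oo] --> 1 - (0 : R).
  by apply: cvgB; [exact: cvg_cst|apply: cvg_natX0; lra].
rewrite subr0 in H.
apply: (squeeze_cvgr _ H (cvg_cst (1 : R))).
near=> n.
have zn : 0 <= z ^+ n <= 1 by rewrite exprn_ge0//= exprn_ile1//; lra.
apply/andP; split.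
  apply: le_trans (bernoulli_le _ zn).
  by rewrite natrM natrX exprMn mulrA.
rewrite exprn_ile1//; lra.
Unshelve. all: end_near. Qed.

Lemma threshold_ge z : 2^-1 <= z <= 1 ->
  (1 - z ^+ n) ^+ (n * 2 ^ n) @[n --> \oo] --> (0 : R).
Proof.
move=> /andP[z0 z1].
apply: (squeeze_cvgr _ (cvg_cst (0 : R)) (@cvg_harmonic R)).
near=> n.
have z2 : 0 <= z by lra.
have zn : 0 <= z ^+ n <= 1 by rewrite exprn_ge0//= exprn_ile1//; lra.
have : 0 <= (1 - z ^+ n) ^+ (n * 2 ^ n) by rewrite exprn_ge0//; lra.
set u := _ ^+ (n * _) => u0; rewrite u0/= /harmonic.
have n1 : 0 < n.+1%:R :> R by [].
rewrite -[leRHS]mul1r ler_pdivlMr//.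
apply: (@le_trans _ _ (u * (1 + z ^+ n) ^+ (n * 2 ^ n))).
  rewrite ler_wpM2l//; apply: le_trans (bernoulli_ge _ _); last by lra.
  rewrite -natr1 addrC lerD2l natrM natrX -mulrA -exprMn.
  by rewrite ler_peMr// exprn_ege1//; lra.
rewrite -exprMn exprn_ile1//.
  by rewrite mulr_ge0//; lra.
have : 0 <= z ^+ n * z ^+ n by rewrite mulr_ge0//; lra.
by lra.
Unshelve. all: end_near. Qed.
End threshold.

(** * Determinacy of measures with an exponential moment *)

Section exponential_moments.
Context {R : realType}.
Local Notation D := (`]0, +oo[%classic : set R).

Lemma exprn_le_expR e n (x : R) : 0 < e -> 0 <= x ->
  x ^+ n <= n`!%:R / e ^+ n * expR (e * x).
Proof.
move=> e0 x0.
rewrite mulrAC ler_pdivlMr ?exprn_gt0// -exprMn mulrC -ler_pdivrMl//.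
rewrite mulrC [x * e]mulrC; have ex : 0 <= e * x by rewrite mulr_ge0// ltW.
case: n => [|n]; first by rewrite expr0 fact0 invr1 mulr1 -expR0 ler_expR.
by apply: le_trans (expR_ge1Dxn n ex); rewrite [leLHS]mulrC lerDr.
Qed.

Variables (s : {measure set R -> \bar R}) (e : R).
Hypothesis e0 : 0 < e.
Hypothesis s_exp : (\int[s]_(x in D) (expR (e * x))%:E < +oo)%E.

Lemma integrable_expR : s.-integrable D (fun x => (expR (e * x))%:E).
Proof.
apply/integrableP; split.
  by apply/measurable_EFinP; apply: measurable_funTS; apply: measurableT_comp => //;
    exact: measurable_funM.
by under eq_integral do rewrite gee0_abs ?lee_fin ?expR_ge0//.
Qed.

Lemma integrable_exprn_expR n t : t <= e / 2 ->
  s.-integrable D (fun x => (x ^+ n * expR (t * x))%:E).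
Proof.
move=> te.
have H := integrableZl _ (n`!%:R / (e / 2) ^+ n) integrable_expR.
apply: le_integrable (H _) => //.
  apply/measurable_EFinP; apply: measurable_funTS; apply: measurable_funM.
    exact: exprn_measurable.
  by apply: measurableT_comp => //; exact: measurable_funM.
move=> x /=; rewrite in_itv/= andbT => x0.
rewrite lee_fin !ger0_norm ?mulr_ge0 ?exprn_ge0 ?expR_ge0 ?invr_ge0 ?divr_ge0
  ?exprn_ge0//; try by rewrite ?divr_ge0// ltW.
have -> : e * x = e / 2 * x + e / 2 * x by field.
rewrite expRD mulrA; apply: ler_pM.
- by rewrite exprn_ge0// ltW.
- exact: expR_ge0.
- by apply: exprn_le_expR; rewrite ?divr_gt0// ltW.
- by rewrite ler_expR ler_pM2r.
Qed.

Lemma integrable_exprn_expRN n t : 0 <= t ->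
  s.-integrable D (fun x => (x ^+ n * expR (- t * x))%:E).
Proof.
by move=> t0; apply: integrable_exprn_expR; rewrite (@le_trans _ _ 0) ?oppr_le0// divr_ge0// ltW.
Qed.

Definition laplace_moment n t := \int[s]_(x in D) (x ^+ n * expR (- t * x)).

(** Moments determine the Laplace transform near the origin through the
    exponential series, and the same expansion moves the base point from [t] to
    [t + u].  The admissible step [e / 2] does not depend on [t], so finitely
    many steps reach any point. *)
Lemma laplace_moment_shift n t u : 0 <= t -> 0 <= u <= e / 2 ->
  \sum_(0 <= k < m) (- u) ^+ k / k`!%:R * laplace_moment (n + k) t @[m --> \oo] -->
  laplace_moment n (t + u).
Proof.
move=> t0 /andP[u0 ue].
pose f m x : R := \sum_(0 <= k < m) (- u) ^+ k / k`!%:R * (x ^+ (n + k) * expR (- t * x)).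
have fi k : s.-integrable D (fun x => ((- u) ^+ k / k`!%:R * (x ^+ (n + k) * expR (- t * x)))%:E).
  exact: (integrableZl _ ((- u) ^+ k / k`!%:R) (integrable_exprn_expRN (n + k) t0)).
have fE x m : f m x = x ^+ n * expR (- t * x) * series (exp_coeff (- u * x)) m.
  rewrite /f /series/= mulr_sumr; apply: eq_bigr => k _.
  by rewrite /exp_coeff/= exprD exprMn; ring.
have fint m : s.-integrable D (EFin \o f m).
  rewrite /f (_ : _ \o _ = fun x => (\sum_(0 <= k < m)
    ((- u) ^+ k / k`!%:R * (x ^+ (n + k) * expR (- t * x)))%:E)%E).
    exact: integrable_sum.
  by apply/funext => x/=; rewrite sumEFin.
have [||||||_ _] := @dominated_convergence _ _ _ s D _ (fun m => EFin \o f m)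
  (fun x => (x ^+ n * expR (- (t + u) * x))%:E) (fun x => (x ^+ n * expR (u * x))%:E).
- by [].
- by move=> m; exact: measurable_int (fint m).
- by apply: measurable_int (integrable_exprn_expRN _ _); rewrite addr_ge0.
- apply/aeW => x; rewrite /= in_itv/= andbT => x0.
  under eq_fun do rewrite fE.
  apply/cvg_EFin; first exact: nearW.
  rewrite /comp/=.
  have -> : x ^+ n * expR (- (t + u) * x) = x ^+ n * expR (- t * x) * expR (- u * x).
    by rewrite -mulrA -expRD; congr (_ * expR _); ring.
  by apply: cvgMr; exact: is_cvg_series_exp_coeff.
- exact: integrable_exprn_expR.
- apply/aeW => x m; rewrite /= in_itv/= andbT => x0; rewrite lee_fin fE.
  rewrite normrM ger0_norm ?mulr_ge0 ?exprn_ge0 ?expR_ge0 ?(ltW x0)//.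
  rewrite -mulrA ler_wpM2l ?exprn_ge0 ?(ltW x0)//.
  apply: (@le_trans _ _ `|series (exp_coeff (- u * x)) m|).
    by rewrite ler_piMl// -expR0 ler_expR mulNr oppr_le0 mulr_ge0//; exact: ltW.
  apply: (@le_trans _ _ (series (exp_coeff (u * x)) m)).
    rewrite /series/=; apply: le_trans (ler_norm_sum _ _ _) _.
    apply: ler_sum => k _; rewrite /exp_coeff mulNr normrM exprNn normrM normrX.
    rewrite normrN1 expr1n mul1r.
    by rewrite !ger0_norm// ?invr_ge0// exprn_ge0// mulr_ge0// ltW.
  apply: nondecreasing_cvgn_le; last exact: is_cvg_series_exp_coeff.
  apply: nondecreasing_series => k _ _; rewrite /exp_coeff.
  by rewrite divr_ge0// exprn_ge0// mulr_ge0// ltW.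
move=> H.
have -> : (fun m => \sum_(0 <= k < m) (- u) ^+ k / k`!%:R * laplace_moment (n + k) t) =
   fun m => \int[s]_(x in D) f m x.
  apply/funext => m; rewrite /f /Rintegral.
  have -> : (\int[s]_(x in D) (\sum_(0 <= k < m) (- u) ^+ k / k`!%:R *
      (x ^+ (n + k) * expR (- t * x)))%:E = \sum_(0 <= k < m)
      \int[s]_(x in D) ((- u) ^+ k / k`!%:R * (x ^+ (n + k) * expR (- t * x)))%:E)%E.
    by rewrite -integral_sum//; apply: eq_integral => x _; rewrite sumEFin.
  rewrite -sum_fine; last first.
    by move=> k _; exact: integrable_fin_num.
  apply: eq_bigr => k _; rewrite /laplace_moment -RintegralZl//.
  exact: integrable_exprn_expRN.
apply: fine_cvg; rewrite fineK//; apply: integrable_fin_num => //.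
by apply: integrable_exprn_expRN; rewrite addr_ge0.
Qed.
End exponential_moments.

(** The function [bump t N] is a polynomial in [expR (- u * x)] with
    [u = N * ln 2 / t], so its integral is a combination of Laplace transforms;
    by the threshold property it tends to the indicator of the points above
    [t]. *)
Section tails.
Context {R : realType}.
Local Notation D := (`]0, +oo[%classic : set R).
Variables (s : {measure set R -> \bar R}) (e : R).
Hypothesis e0 : 0 < e.
Hypothesis s_exp : (\int[s]_(x in D) (expR (e * x))%:E < +oo)%E.

Let bump t N x : R := (1 - expR (- (ln 2 / t) * x) ^+ N) ^+ (N * 2 ^ N).

Let bumpE t N x : bump t N x = \sum_(i < (N * 2 ^ N).+1)
  (((-1) ^+ i *+ 'C(N * 2 ^ N, i)) * (x ^+ 0 * expR (- ((ln 2 / t) * N%:R * i%:R) * x))).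
Proof.
rewrite /bump exprBn; apply: eq_bigr => i _.
rewrite expr1n mulr1 -exprM -expRM_natr expr0 mul1r mulrnAl natrM.
congr (_ * expR _ *+ _).
by ring.
Qed.

Let ln2t (t : R) : 0 < t -> 0 <= ln 2 / t.
Proof. by move=> t0; rewrite divr_ge0 ?ln_ge0 ?ler1n//; exact: ltW. Qed.

Let int_term (t : R) N (i : nat) : 0 < t ->
  s.-integrable D (fun x => ((((-1) ^+ i *+ 'C(N * 2 ^ N, i)) *
    (x ^+ 0 * expR (- ((ln 2 / t) * N%:R * i%:R) * x))))%:E).
Proof.
move=> t0; apply: (integrableZl _ ((-1) ^+ i *+ 'C(N * 2 ^ N, i))
  (integrable_exprn_expRN e0 s_exp 0 _)) => //.
by apply: mulr_ge0 => //; apply: mulr_ge0 => //; exact: ln2t.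
Qed.

Let integral_bump (t : R) N : 0 < t -> (\int[s]_(x in D) (bump t N x)%:E =
  (\sum_(i < (N * 2 ^ N).+1) ((-1) ^+ i *+ 'C(N * 2 ^ N, i)) *
     laplace_moment s 0 (ln 2 / t * N%:R * i%:R))%:E)%E.
Proof.
move=> t0.
have -> : (\int[s]_(x in D) (bump t N x)%:E = \sum_(i < (N * 2 ^ N).+1)
    \int[s]_(x in D) (((-1) ^+ i *+ 'C(N * 2 ^ N, i)) *
      (x ^+ 0 * expR (- ((ln 2 / t) * N%:R * i%:R) * x)))%:E)%E.
  rewrite -integral_sum//; last by move=> i; exact: int_term.
  by apply: eq_integral => x _; rewrite bumpE sumEFin.
rewrite -sumEFin; apply: eq_bigr => i _; rewrite /laplace_moment -RintegralZl//.
  by rewrite /Rintegral fineK//; apply: integrable_fin_num => //; exact: int_term.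
apply: (integrable_exprn_expRN e0 s_exp).
by apply: mulr_ge0 => //; apply: mulr_ge0 => //; exact: ln2t.
Qed.

Lemma tail_from_laplace_moments (t : R) : 0 < t ->
  (\sum_(i < (N * 2 ^ N).+1) ((-1) ^+ i *+ 'C(N * 2 ^ N, i)) *
     laplace_moment s 0 (ln 2 / t * N%:R * i%:R))%:E @[N --> \oo] --> s `]t, +oo[%classic.
Proof.
move=> t0.
have z01 x : 0 < x -> 0 <= expR (- (ln 2 / t) * x) <= 1.
  move=> x0; rewrite expR_ge0/= -[leRHS]expR0 ler_expR mulNr oppr_le0.
  by apply: mulr_ge0; [exact: ln2t|exact: ltW].
have [||||||_ _] := @dominated_convergence _ _ _ s D _ (fun N => EFin \o bump t N)
  (fun x => (\1_(`]t, +oo[%classic : set R) x)%:E) (fun x => (x ^+ 0 * expR (- 0 * x))%:E).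
- by [].
- move=> N; apply/measurable_EFinP; apply: measurable_funTS.
  apply: measurable_funX; apply: measurable_funB => //; apply: measurable_funX.
  by apply: measurableT_comp => //; exact: measurable_funM.
- by apply/measurable_EFinP.
- apply/aeW => x; rewrite /= in_itv/= andbT => x0.
  apply/cvg_EFin; first exact: nearW.
  rewrite /comp/= indicE.
  have half : expR (- (ln 2 / t) * t) = 2^-1 by rewrite mulNr divfK ?gt_eqF// expRN lnK ?posrE//.
  have l0 : - (ln 2 / t) < 0 by rewrite oppr_lt0 divr_gt0// ln_gt0// ltr1n.
  have /andP[z0 z1] := z01 _ x0.
  have [xt|xt] := ltP t x.
    rewrite mem_set/= ?in_itv/= ?xt//.
    by apply: threshold_lt; rewrite z0/= -half ltr_expR ltr_nM2l.
  rewrite memNset/=; last by rewrite in_itv/= andbT; apply/negP; rewrite -leNgt.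
  by apply: threshold_ge; rewrite z1 andbT -half ler_expR ler_nM2l.
- exact: integrable_exprn_expRN e0 s_exp _ _ _.
- apply/aeW => x N; rewrite /= in_itv/= andbT => x0; rewrite lee_fin.
  have /andP[z0 z1] := z01 _ x0.
  rewrite expr0 mul1r oppr0 mul0r expR0 normrX exprn_ile1//.
  have := exprn_ge0 N z0; have := exprn_ile1 N z0 z1.
  by set u := _ ^+ N => u0 u1; rewrite ger0_norm; lra.
rewrite integral_indic// setIidl; last first.
  by move=> x; rewrite /= !in_itv/= !andbT; exact: lt_trans.
apply: cvg_trans; apply: near_eq_cvg; apply: nearW => N /=.
by rewrite integral_bump.
Qed.
End tails.

Section determinacy.
Context {R : realType}.
Local Notation D := (`]0, +oo[%classic : set R).
Variables (s1 s2 : {measure set R -> \bar R}) (e : R).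
Hypothesis e0 : 0 < e.
Hypothesis s1_exp : (\int[s1]_(x in D) (expR (e * x))%:E < +oo)%E.
Hypothesis s2_exp : (\int[s2]_(x in D) (expR (e * x))%:E < +oo)%E.
Hypothesis eq_mom : forall n,
  \int[s1]_(x in D) (x ^+ n) = \int[s2]_(x in D) (x ^+ n).

Let eq_laplace_moment n t : 0 <= t -> laplace_moment s1 n t = laplace_moment s2 n t.
Proof.
move=> t0.
have step u j m : 0 <= u <= e / 2 ->
    laplace_moment s1 m (j%:R * u) = laplace_moment s2 m (j%:R * u).
  move=> ue; have [u0 _] := andP ue; elim: j m => [|j IH] m.
    rewrite mul0r /laplace_moment; under eq_Rintegral do rewrite oppr0 mul0r expR0 mulr1.
    by rewrite eq_mom; under [RHS]eq_Rintegral do rewrite oppr0 mul0r expR0 mulr1.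
  have ju : 0 <= j%:R * u by rewrite mulr_ge0.
  rewrite -natr1 mulrDl mul1r.
  have h1 := laplace_moment_shift (n := m) e0 s1_exp ju ue.
  have h2 := laplace_moment_shift (n := m) e0 s2_exp ju ue.
  apply: (cvg_unique _ h1) => //.
  apply: cvg_trans h2; apply: near_eq_cvg; apply: nearW => N.
  by apply: eq_bigr => k _; rewrite IH.
pose j := (Num.truncn (t / (e / 2))).+1.
have -> : t = j%:R * (t / j%:R) by rewrite mulrC divfK// pnatr_eq0.
apply: step; rewrite divr_ge0//= ler_pdivrMr// mulrC -ler_pdivrMr ?divr_gt0//.
by rewrite ltW// truncnS_gt.
Qed.

Let lE (s : {measure set R -> \bar R}) : s D = (\int[s]_(x in D) 1)%E.
Proof. by rewrite integral_cst// mul1e. Qed.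

Let fin (s : {measure set R -> \bar R}) :
  (\int[s]_(x in D) (expR (e * x))%:E < +oo)%E -> (s D) \is a fin_num.
Proof.
move=> /integrable_expR; rewrite lE => h; apply: integrable_fin_num => //.
apply: le_integrable h => // x; rewrite /= in_itv/= andbT => x0.
rewrite lee_fin ger0_norm// ger0_norm ?expR_ge0//.
by rewrite -[leLHS]expR0 ler_expR mulr_ge0// ltW.
Qed.

Let eq_tail t : 0 <= t -> s1 `]t, +oo[%classic = s2 `]t, +oo[%classic.
Proof.
rewrite le_eqVlt => /predU1P[<-|t0].
  rewrite -(fineK (fin s1_exp)) -(fineK (fin s2_exp)); congr EFin.
  by have := eq_mom 0; rewrite /Rintegral; under eq_integral do rewrite expr0;
    under [in RHS]eq_integral do rewrite expr0; rewrite -!lE.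
have h1 := tail_from_laplace_moments e0 s1_exp t0.
have h2 := tail_from_laplace_moments e0 s2_exp t0.
apply: cvg_unique h1 _ => //.
apply: cvg_trans h2; apply: near_eq_cvg; apply: nearW => N.
congr EFin; apply: eq_bigr => i _; rewrite eq_laplace_moment//.
by apply: mulr_ge0 => //; apply: mulr_ge0 => //; rewrite divr_ge0// ?ln_ge0 ?ler1n// ltW.
Qed.

(** Equal moments give equal Laplace transforms, hence equal tails, and the
    tails generate the Borel sets. *)
Lemma moment_determinacy A : measurable A -> s1 (A `&` D) = s2 (A `&` D).
Proof.
move=> mA.
have mD : measurable D by [].
change (mrestr s1 mD A = mrestr s2 mD A).
pose g (k : nat) : set R := `](- k%:R), +oo[%classic.
have eqg t : mrestr s1 mD `]t, +oo[%classic = mrestr s2 mD `]t, +oo[%classic.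
  rewrite /mrestr; have -> : `]t, +oo[%classic `&` D = `]Num.max t 0, +oo[%classic :> set R.
    by apply/seteqP; split => x /=; rewrite !in_itv/= !andbT gt_max => /andP.
  by apply: eq_tail; rewrite le_max lexx orbT.
refine (@measure_unique _ R R (@RGenOInfty.G R) g _ _ _ _
  (mrestr s1 mD) (mrestr s2 mD) _ _ A mA).
- exact: RGenOInfty.measurableE.
- move=> _ _ [t ->] [u ->]; exists (Num.max t u).
  by apply/seteqP; split => x /=; rewrite !in_itv/= !andbT gt_max => /andP.
- by move=> k; exists (- k%:R).
- apply/seteqP; split => // x _; exists (Num.truncn `|x|).+1 => //=.
  rewrite /g/= in_itv/= andbT ltrNl (le_lt_trans _ (truncnS_gt _))//.
  by rewrite -normrN ler_norm.
- by move=> _ [t ->]; exact: eqg.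
- move=> k; rewrite /mrestr.
  apply: le_lt_trans (_ : s1 D < +oo)%E; last first.
    by rewrite -ge0_fin_numE// fin.
  apply: le_measure; [rewrite inE|by rewrite inE|exact: subIsetr].
  by apply: measurableI => //; exact: measurable_itv.
Qed.
End determinacy.

(** * Integration against a measure with a density *)

(** A version of the measure with density [g], given as a bundled measure, so
    that measures with a density can be compared with arbitrary ones. *)
Section density.
Import HBNNSimple.
Context d (T : measurableType d) (R : realType).
Variables (mu : {measure set T -> \bar R}) (g : T -> R).
Hypotheses (mg : measurable_fun [set: T] g) (g0 : forall x, 0 <= g x).

Definition density (A : set T) : \bar R := (\int[mu]_(x in A) (g x)%:E)%E.

Let density0 : density set0 = 0%E.
Proof. exact: integral_set0. Qed.

Let density_ge0 A : (0 <= density A)%E.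
Proof. by apply: integral_ge0 => x _; rewrite lee_fin. Qed.

Let density_sigma_additive : semi_sigma_additive density.
Proof.
move=> F mF tF mUF; rewrite /density; apply: cvg_toP.
  apply: ereal_nondecreasing_is_cvgn => m n mn.
  by apply: lee_sum_nneg_natr => // k _ _; exact: density_ge0.
rewrite ge0_integral_bigcup//=.
- by apply/measurable_funTS/measurable_EFinP.
- by move=> x _; rewrite lee_fin.
Qed.

HB.instance Definition _ := isMeasure.Build _ _ _
  density density0 density_ge0 density_sigma_additive.

Definition density_measure : {measure set T -> \bar R} := density.

Lemma integral_density (D : set T) (f : T -> \bar R) : measurable D ->
  measurable_fun D f -> (forall x, D x -> (0 <= f x)%E) ->
  (\int[density_measure]_(x in D) f x = \int[mu]_(x in D) (f x * (g x)%:E))%E.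
Proof.
move=> mD mf f0.
have mgD : measurable_fun D (EFin \o g) by apply/measurable_funTS/measurable_EFinP.
pose f_ := nnsfun_approx mD mf.
have gE x : (0 <= (g x)%:E)%E by rewrite lee_fin.
transitivity (limn (fun n => \int[density_measure]_(x in D) (f_ n x)%:E)%E).
  rewrite -monotone_convergence//.
  - apply: eq_integral => y /[!inE] yD; apply/esym/cvg_lim => //.
    by apply: cvg_nnsfun_approx.
  - by move=> n; exact/measurable_EFinP/measurable_funTS.
  - by move=> n y _; rewrite lee_fin.
  - by move=> y _ m n mn; rewrite lee_fin; exact/lefP/nd_nnsfun_approx.
rewrite (_ : (fun n => _) =
    (fun n => \int[mu]_(x in D) ((f_ n x)%:E * (g x)%:E))%E).
  rewrite -monotone_convergence//; last 3 first.
  - by move=> n; apply: emeasurable_funM => //; exact/measurable_EFinP/measurable_funTS.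
  - by move=> n x _; rewrite mule_ge0// lee_fin.
  - by move=> x _ m n mn; rewrite lee_wpmul2r// lee_fin; exact/lefP/nd_nnsfun_approx.
  apply: eq_integral => x /[!inE] Dx; apply/cvg_lim => //.
  apply: cvgeZr => //; exact: cvg_nnsfun_approx.
apply/funext => n.
transitivity (\sum_(k \in range (f_ n))
    \int[density_measure]_(x in D) (k * \1_(f_ n @^-1` [set k]) x)%:E)%E.
  under eq_integral do rewrite fimfunE -fsumEFin//.
  rewrite ge0_integral_fsum//.
  - by move=> y; apply/measurable_funTS/measurable_EFinP/measurable_funM.
  - by move=> y x _; rewrite nnfun_muleindic_ge0.
transitivity (\sum_(k \in range (f_ n))
    \int[mu]_(x in D) ((k * \1_(f_ n @^-1` [set k]) x)%:E * (g x)%:E))%E; last first.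
  rewrite -ge0_integral_fsum//.
  - apply: eq_integral => x _; rewrite -ge0_mule_fsuml; last first.
      by move=> r; rewrite nnfun_muleindic_ge0.
    by rewrite fsumEFin// -fimfunE.
  - move=> y; apply: emeasurable_funM => //.
    by apply/measurable_funTS/measurable_EFinP/measurable_funM.
  - by move=> y x _; rewrite mule_ge0// nnfun_muleindic_ge0.
apply: eq_fsbigr => k _.
rewrite integralZl_indic_nnsfun// integral_indic//=.
have [k0|k0] := ltP k 0.
  rewrite preimage_nnfun0// set0I measure0 mule0; apply/esym.
  by apply: integral0_eq => x _; rewrite indic0 mulr0 mul0e.
under [RHS]eq_integral do rewrite EFinM -muleA.
rewrite ge0_integralZl_EFin//; first last.
- by apply: emeasurable_funM => //; apply/measurable_funTS/measurable_EFinP.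
- by move=> x _; rewrite mule_ge0// lee_fin.
congr (_ * _)%E; rewrite /density_measure/= /density setIC integral_mkcondr.
by apply: eq_integral => x _; rewrite epatch_indic muleC.
Qed.
End density.

(** * Contiguity relations of the Kummer integrals *)

Section kummer_mass.
Context {R : realType}.
Implicit Types g a b c x : R.
Local Notation leb := (@lebesgue_measure R).

Definition kummer_massR g a b c : R := fine (kummer_mass g a b c).

Lemma kummer_massRE g a b c : 0 <= g -> 0 < a -> 0 < c ->
  (kummer_massR g a b c)%:E = kummer_mass g a b c.
Proof.
move=> g0 a0 c0; rewrite /kummer_massR fineK// ge0_fin_numE ?kummer_mass_lty//.
exact/ltW/kummer_mass_gt0.
Qed.

Lemma kummer_massR_gt0 g a b c : 0 <= g -> 0 < a -> 0 < c -> 0 < kummer_massR g a b c.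
Proof.
by move=> g0 a0 c0; rewrite -lte_fin kummer_massRE// kummer_mass_gt0.
Qed.

Lemma integrable_kummer_fun g a b c : 0 <= g -> 0 < a -> 0 < c ->
  leb.-integrable setT (EFin \o kummer_fun g a b c).
Proof.
move=> g0 a0 c0; apply/integrableP; split.
  by apply/measurable_EFinP; exact: measurable_kummer_fun.
under eq_integral do rewrite /= ger0_norm ?kummer_fun_ge0//.
exact: kummer_mass_lty.
Qed.

Lemma kummer_funX g a b c x p q : 0 <= g -> 0 < x ->
  kummer_fun g (a + p%:R) (b + q%:R) c x =
  kummer_fun g a b c x * (x ^+ p / (1 + g * x) ^+ q).
Proof.
move=> g0 x0; have gx : 0 < 1 + g * x by rewrite ltr_pwDl// mulr_ge0// ltW.
rewrite !kummer_funE// (_ : a + p%:R - 1 = (a - 1) + p%:R); last by ring.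
rewrite !powRD ?(gt_eqF x0) ?(gt_eqF gx) ?implybT// !powR_mulrn ?ltW//.
by field; rewrite !gt_eqF ?exprn_gt0 ?powR_gt0.
Qed.

Lemma kummer_fun_split g a b c x : 0 <= g ->
  kummer_fun g a b c x =
  kummer_fun g a (b + 1) c x + g * kummer_fun g (a + 1) (b + 1) c x.
Proof.
move=> g0; have [x0|x0] := leP x 0; first by rewrite !kummer_fun_eq0// mulr0 addr0.
have gx : 0 < 1 + g * x by rewrite ltr_pwDl// mulr_ge0// ltW.
have := @kummer_funX g a b c x 0 1 g0 x0; have := @kummer_funX g a b c x 1 1 g0 x0.
rewrite !mulr1n addr0 => -> ->; rewrite expr0 !expr1.
by field; rewrite gt_eqF.
Qed.

Lemma kummer_massR_split g a b c : 0 <= g -> 0 < a -> 0 < c ->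
  kummer_massR g a b c = kummer_massR g a (b + 1) c + g * kummer_massR g (a + 1) (b + 1) c.
Proof.
move=> g0 a0 c0; have a10 : 0 < a + 1 by rewrite addr_gt0.
rewrite /kummer_massR /kummer_mass -!/(Rintegral _ _ _).
transitivity (\int[leb]_x (kummer_fun g a (b + 1) c x + g * kummer_fun g (a + 1) (b + 1) c x)).
  by apply: eq_Rintegral => x _; exact: kummer_fun_split.
rewrite RintegralD//= ?RintegralZl//.
- exact: integrable_kummer_fun.
- exact: integrable_kummer_fun.
- exact: (integrableZl _ g (integrable_kummer_fun _ _ _ _)).
Qed.

(** The function [kummer_fun g (a + 1) b c], which vanishes at both ends of the
    half line, in a form that is convenient to differentiate. *)
Let F g a b c x := expR (a * ln x - b * ln (1 + g * x) - c * x).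

Let FE g a b c x : 0 <= g -> 0 < x -> F g a b c x = kummer_fun g (a + 1) b c x.
Proof.
move=> g0 x0; have gx : 0 < 1 + g * x by rewrite ltr_pwDl// mulr_ge0// ltW.
rewrite kummer_funE// addrK /powR !gt_eqF// /F !expRD !expRN mulNr expRN.
by field; rewrite !gt_eqF ?expR_gt0.
Qed.

Let dF g a b c x : 0 <= g -> 0 < x -> is_derive x 1 (F g a b c)
  (a * kummer_fun g a b c x - g * b * kummer_fun g (a + 1) (b + 1) c x
   - c * kummer_fun g (a + 1) b c x).
Proof.
move=> g0 x0; have gx : 0 < 1 + g * x by rewrite ltr_pwDl// mulr_ge0// ltW.
have -> : a * kummer_fun g a b c x - g * b * kummer_fun g (a + 1) (b + 1) c x
   - c * kummer_fun g (a + 1) b c x = F g a b c x * (a / x - b * (g / (1 + g * x)) - c).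
  rewrite FE//.
  have := @kummer_funX g a b c x 1 0 g0 x0; have := @kummer_funX g a b c x 1 1 g0 x0.
  rewrite !mulr1n addr0 => -> ->; rewrite expr0 !expr1.
  by field; rewrite !gt_eqF.
have h0 : is_derive x 1 (fun y => 1 + g * y) g.
  apply: (is_derive_eq (is_deriveD (is_derive_cst (1 : R) x 1)
    (is_deriveZ g (is_derive_id x 1)))).
  by rewrite add0r [LHS]mulr1.
have h1 : is_derive x 1 (fun y => ln (1 + g * y)) (g / (1 + g * x)).
  rewrite mulrC.
  exact: (@is_derive1_comp R (@ln R) (fun y => 1 + g * y) x _ _ (is_derive1_ln gx) h0).
have h2 : is_derive x 1 (fun y => a * ln y - b * ln (1 + g * y) - c * y)
    (a / x - b * (g / (1 + g * x)) - c).
  apply: (is_derive_eq (is_deriveB (is_deriveB (is_deriveZ a (is_derive1_ln x0))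
    (is_deriveZ b h1)) (is_deriveZ c (is_derive_id x 1)))).
  by congr (_ - _); rewrite [LHS]mulr1.
exact: (@is_derive1_comp R (@expR R) (fun y => a * ln y - b * ln (1 + g * y) - c * y) x _ _ _ h2).
Qed.

Let F0 g a b c : 0 <= g -> 0 < a -> 0 < c ->
  F g a b c n.+2%:R^-1 @[n --> \oo] --> (0 : R).
Proof.
move=> g0 a0 c0.
pose C := expR (`|b| * ln (1 + g)).
have H : C * n.+2%:R^-1 `^ a @[n --> \oo] --> C * (0 : R).
  apply: cvgMr; move/cvg_at_rightP: (powR_cvg0 a0); apply; split.
    by move=> n; rewrite invr_gt0.
  by have := @cvg_harmonic R; rewrite -cvg_shiftS.
rewrite mulr0 in H.
apply: (squeeze_cvgr _ (cvg_cst (0 : R)) H).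
apply: nearW => n; set x := n.+2%:R^-1; have x0 : 0 < x by rewrite invr_gt0.
have x1 : x <= 1 by rewrite invf_le1// ler1n.
rewrite expR_ge0/= /powR gt_eqF// -expRD ler_expR.
have gx : 0 <= g * x by rewrite mulr_ge0// ltW.
have l0 : 0 <= ln (1 + g * x) by rewrite ln_ge0// lerDl.
have l1 : ln (1 + g * x) <= ln (1 + g).
  by rewrite ler_ln ?posrE ?ltr_wpDr// lerD2l ler_piMr.
have : - b * ln (1 + g * x) <= `|b| * ln (1 + g).
  apply: (@le_trans _ _ (`|b| * ln (1 + g * x))); last by rewrite ler_wpM2l.
  by rewrite ler_wpM2r// -normrN ler_norm.
have : 0 <= c * x by rewrite mulr_ge0// ltW.
by lra.
Qed.

Let Foo g a b c : 0 <= g -> 0 < c -> F g a b c n.+2%:R @[n --> \oo] --> (0 : R).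
Proof.
move=> g0 c0.
pose B := `|b| * ln (1 + g).
(* [x ^+ N] dominates the powers of [x], and one more power is traded for the
   exponential, which leaves a bound by a multiple of [1 / x] *)
pose N := (Num.truncn (`|a| + `|b|)).+1.
pose K := (N.+1)`!%:R / c ^+ N.+1.
have H : (expR B * K) * n.+2%:R^-1 @[n --> \oo] --> (expR B * K) * (0 : R).
  by apply: cvgMr; have := @cvg_harmonic R; rewrite -cvg_shiftS.
rewrite mulr0 in H.
apply: (squeeze_cvgr _ (cvg_cst (0 : R)) H).
apply: nearW => n; set x := n.+2%:R; have x0 : 0 < x :> R by [].
have x1 : 1 <= x :> R by rewrite ler1n.
rewrite expR_ge0/= ler_pdivlMr//.
have gx : 0 <= g * x by rewrite mulr_ge0// ltW.
have lx : 0 <= ln x by rewrite ln_ge0.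
have l0 : 0 <= ln (1 + g * x) by rewrite ln_ge0// lerDl.
have l1 : ln (1 + g * x) <= ln (1 + g) + ln x.
  have g1 : 0 < 1 + g by rewrite ltr_wpDr.
  have gx1 : 0 < 1 + g * x by rewrite ltr_wpDr.
  have g1x : 0 < (1 + g) * x by rewrite mulr_gt0.
  by rewrite -lnM ?posrE// ler_ln ?posrE// mulrDl mul1r lerD2r.
have : a * ln x <= `|a| * ln x by rewrite ler_wpM2r// ler_norm.
have : - b * ln (1 + g * x) <= B + `|b| * ln x.
  apply: (@le_trans _ _ (`|b| * ln (1 + g * x))).
    by rewrite ler_wpM2r// -normrN ler_norm.
  rewrite /B -mulrDr; apply: ler_wpM2l; [exact: normr_ge0|exact: l1].
have : (`|a| + `|b|) * ln x <= N%:R * ln x.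
  by rewrite ler_wpM2r//; apply/ltW; exact: truncnS_gt.
move=> h1 h2 h3.
apply: (@le_trans _ _ (expR B * (x ^+ N * expR (- c * x)) * x)).
  rewrite ler_wpM2r ?(ltW x0)// -[x in x ^+ N]lnK ?posrE// -expRM_natl -!expRD ler_expR.
  by lra.
rewrite -!mulrA ler_wpM2l ?expR_ge0// mulrCA -exprSr mulrC.
have := @exprn_le_expR R c N.+1 x c0 (ltW x0).
by rewrite mulNr expRN ler_pdivrMr ?expR_gt0.
Qed.

(** An exhaustion of the half line by compact intervals on which [F] is
    smooth. *)
Let E (n : nat) : set R := `[n.+2%:R^-1, n.+2%:R]%classic.

Let FTC g a b c n : 0 <= g -> 0 < a -> 0 < c ->
  a * \int[leb]_(x in E n) kummer_fun g a b c x
  - g * b * \int[leb]_(x in E n) kummer_fun g (a + 1) (b + 1) c x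
  - c * \int[leb]_(x in E n) kummer_fun g (a + 1) b c x =
  F g a b c n.+2%:R - F g a b c n.+2%:R^-1.
Proof.
move=> g0 a0 c0; have a10 : 0 < a + 1 by rewrite addr_gt0.
have n0 : 0 < n.+2%:R :> R by [].
have lt : n.+2%:R^-1 < n.+2%:R :> R.
  by rewrite (@lt_trans _ _ 1)// ?ltr1n// invf_lt1// ltr1n.
have Epos x : n.+2%:R^-1 <= x -> 0 < x.
  by apply: lt_le_trans; rewrite invr_gt0.
have mE : measurable (E n) by exact: measurable_itv.
have int a' b' k : 0 < a' -> leb.-integrable (E n) (fun x => (k * kummer_fun g a' b' c x)%:E).
  move=> a'0; apply: (integrableS measurableT) => //.
  exact: (integrableZl _ k (integrable_kummer_fun _ _ _ _)).
rewrite -!RintegralZl//; try by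
  (apply: (integrableS measurableT) => //; exact: integrable_kummer_fun).
rewrite -!RintegralB//; try exact: int; last first.
  exact: (integrableB _ (int _ _ _ _) (int _ _ _ _)).
pose f x := a * F g (a - 1) b c x - g * b * F g a (b + 1) c x - c * F g a b c x.
transitivity (\int[leb]_(x in E n) f x).
  apply: eq_Rintegral => x; rewrite inE /E/= in_itv/= => /andP[/Epos x0 _].
  by rewrite /f !FE// subrK.
rewrite /Rintegral (@continuous_FTC2 R f (F g a b c))//.
- apply: derivable_within_continuous => x; rewrite in_itv/= => /andP[/Epos x0 _].
  have [H _] := is_deriveB (is_deriveB (is_deriveZ a (dF (a - 1) b c g0 x0))
    (is_deriveZ (g * b) (dF a (b + 1) c g0 x0))) (is_deriveZ c (dF a b c g0 x0)).
  exact: H.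
- split.
  + by move=> x; rewrite in_itv/= => /andP[/ltW/Epos x0 _]; apply: ex_derive; exact: dF.
  + apply: cvg_at_right_filter; apply: differentiable_continuous; apply/derivable1_diffP.
    by apply: ex_derive; apply: dF => //; rewrite invr_gt0.
  + apply: cvg_at_left_filter; apply: differentiable_continuous; apply/derivable1_diffP.
    by apply: ex_derive; apply: dF.
- move=> x; rewrite in_itv/= => /andP[/ltW/Epos x0 _].
  by rewrite derive1E (@derive_val _ _ _ _ _ _ _ (dF a b c g0 x0)) /f !FE// subrK.
Qed.

Let cvgE g a b c : 0 <= g -> 0 < a -> 0 < c ->
  \int[leb]_(x in E n) kummer_fun g a b c x @[n --> \oo] --> kummer_massR g a b c.
Proof.
move=> g0 a0 c0.
have UE : \bigcup_n E n = `]0, +oo[%classic.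
  apply/seteqP; split => x /=.
    move=> [n _]; rewrite /E/= !in_itv/= => /andP[h _].
    by rewrite andbT (lt_le_trans _ h)// invr_gt0.
  rewrite in_itv/= andbT => x0.
  exists (Num.truncn x + Num.truncn x^-1)%N => //; rewrite /E/= in_itv/=; apply/andP; split.
    rewrite -[leRHS]invrK lef_pV2 ?posrE ?invr_gt0// (le_trans (ltW (truncnS_gt _)))// ler_nat.
    by apply: leqW; rewrite ltnS leq_addl.
  by rewrite (le_trans (ltW (truncnS_gt _)))// ler_nat; apply: leqW; rewrite ltnS leq_addr.
have mk : measurable_fun setT (fun x => (kummer_fun g a b c x)%:E).
  by apply/measurable_EFinP; exact: measurable_kummer_fun.
have -> : kummer_massR g a b c = fine (\int[leb]_(x in \bigcup_n E n) (kummer_fun g a b c x)%:E)%E.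
  rewrite UE /kummer_massR /kummer_mass [in RHS]integral_mkcond.
  congr fine; apply: eq_integral => x _.
  rewrite patchE; case: ifPn => //; rewrite notin_setE/= in_itv/= andbT => /negP.
  by rewrite -leNgt => x0; rewrite kummer_fun_eq0.
apply: fine_cvg; rewrite fineK.
  apply: ge0_nondecreasing_set_cvg_integral.
  - move=> m n mn; rewrite subsetEset => x; rewrite /E/= !in_itv/= => /andP[h1 h2].
    rewrite (le_trans _ h1)/=; last by rewrite lef_pV2 ?posrE// ler_nat !ltnS.
    by rewrite (le_trans h2)// ler_nat !ltnS.
  - by move=> i; exact: measurable_itv.
  - by move=> i; exact: measurable_funTS.
  - by move=> i x _; rewrite lee_fin kummer_fun_ge0.
rewrite UE; apply: integrable_fin_num => //; apply: (integrableS measurableT) => //.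
exact: integrable_kummer_fun.
Qed.

(** Integration by parts: the derivative of [kummer_fun g (a + 1) b c] has
    integral zero. *)
Lemma kummer_massR_parts g a b c : 0 <= g -> 0 < a -> 0 < c ->
  c * kummer_massR g (a + 1) b c =
  a * kummer_massR g a b c - g * b * kummer_massR g (a + 1) (b + 1) c.
Proof.
move=> g0 a0 c0; have a10 : 0 < a + 1 by rewrite addr_gt0.
apply/esym/eqP; rewrite -subr_eq0; apply/eqP.
have h : F g a b c n.+2%:R - F g a b c n.+2%:R^-1 @[n --> \oo] --> (0 : R) - 0.
  by apply: cvgB; [exact: Foo|exact: F0].
rewrite subr0 in h.
have h' : a * kummer_massR g a b c - g * b * kummer_massR g (a + 1) (b + 1) c -
    c * kummer_massR g (a + 1) b c = 0 :> R.
  apply: (cvg_unique _ _ h) => //.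
  apply: cvg_trans (_ : (a * \int[leb]_(x in E n) kummer_fun g a b c x
    - g * b * \int[leb]_(x in E n) kummer_fun g (a + 1) (b + 1) c x
    - c * \int[leb]_(x in E n) kummer_fun g (a + 1) b c x) @[n --> \oo] --> _).
    by apply: near_eq_cvg; apply: nearW => n; rewrite FTC.
  by apply: cvgB; [apply: cvgB|]; apply: cvgMr; exact: cvgE.
by rewrite h'.
Qed.

End kummer_mass.

(** * Contiguous moment arrays are unique up to a factor *)

Section casoratian.
Context {R : realType}.
Variables (g A B C : R).
Hypotheses (g0 : 0 < g) (A0 : 0 < A) (B0 : 0 < B) (C0 : 0 < C).

(** The two contiguity relations of the Kummer integrals with parameters
    shifted by [p] and [q]. *)
Definition contiguous (y : nat -> nat -> R) :=
  (forall p q, y p q = y p q.+1 + g * y p.+1 q.+1) /\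
  (forall p q, C * y p.+1 q = (A + p%:R) * y p q - g * (B + q%:R) * y p.+1 q.+1).

(** A moment array of a measure with finite moments decays along the diagonal
    faster than any power of [n], once normalized by [g ^+ n]. *)
Definition tail_decay (y : nat -> nat -> R) := forall N i, exists K,
  forall n, 'C(n + N, N)%:R * (g ^+ n * y (n + i)%N n) <= K.

Variables y z : nat -> nat -> R.
Hypotheses (cy : contiguous y) (cz : contiguous z).
Hypotheses (y0 : forall p q, 0 < y p q) (z0 : forall p q, 0 < z p q).
Hypotheses (ty : tail_decay y) (tz : tail_decay z).

(** The Casoratian of the two solutions along the diagonal. *)
Let W n := g ^+ n * y n n * (g ^+ n * z n.+1 n) - g ^+ n * y n.+1 n * (g ^+ n * z n n).

Let W_step n : (B + n%:R) * W n.+1 = (A + n%:R) * W n.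
Proof.
have [y1 y2] := cy; have [z1 z2] := cz.
have ey1 := y1 n.+1 n; have ey2 := y2 n n; have ez1 := z1 n.+1 n; have ez2 := z2 n n.
rewrite /W !exprS.
have -> : g * g ^+ n * y n.+1 n.+1 * (g * g ^+ n * z n.+2 n.+1) -
    g * g ^+ n * y n.+2 n.+1 * (g * g ^+ n * z n.+1 n.+1) =
    g ^+ n * g ^+ n * g * (y n.+1 n.+1 * (z n.+1 n.+1 + g * z n.+2 n.+1)
     - (y n.+1 n.+1 + g * y n.+2 n.+1) * z n.+1 n.+1) by ring.
rewrite -ey1 -ez1.
have -> : (B + n%:R) * (g ^+ n * g ^+ n * g * (y n.+1 n.+1 * z n.+1 n - y n.+1 n * z n.+1 n.+1)) =
   g ^+ n * g ^+ n * (((A + n%:R) * z n n - g * (B + n%:R) * z n.+1 n.+1) * y n.+1 n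
   - ((A + n%:R) * y n n - g * (B + n%:R) * y n.+1 n.+1) * z n.+1 n
   + (A + n%:R) * (y n n * z n.+1 n - y n.+1 n * z n n)) by ring.
by rewrite -ey2 -ez2; ring.
Qed.

(** The step relation makes the Casoratian change only by the factors
    [(A + n) / (B + n)], that is, polynomially in [n], whereas it tends to zero
    faster than any power of [n].  In quantitative terms, its product with the
    binomial coefficient ['C(n + N, N)] does not decrease if [N] is large, but
    is bounded by a multiple of [1 / n]. *)
Lemma casoratian_eq0 : y 0 0 * z 1 0 = y 1 0 * z 0 0.
Proof.
(* both [B <= N] and [B <= N * A] are needed for the monotonicity of [X] *)
pose N := (Num.truncn (B + B / A)).+1.
have hN : B + B / A <= N%:R by apply/ltW; exact: truncnS_gt.
have BA0 : 0 < B / A by rewrite divr_gt0.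
have NB : B <= N%:R by rewrite (le_trans _ hN)// lerDl ltW.
have NA : B <= N%:R * A by rewrite -ler_pdivrMr// (le_trans _ hN)// lerDr ltW.
pose X n := 'C(n + N, N)%:R * `|W n|.
have Xnd n : X 0 <= X n.
  elim: n => // n /le_trans; apply.
  have BN : 0 < B + n%:R by rewrite ltr_pwDl.
  have AN : 0 < A + n%:R by rewrite ltr_pwDl.
  have n1 : 0 < n.+1%:R :> R by [].
  rewrite -(ler_pM2l BN) -(ler_pM2l n1) /X.
  have -> : n.+1%:R * ((B + n%:R) * ('C(n.+1 + N, N)%:R * `|W n.+1|)) =
      (n.+1%:R * 'C(n.+1 + N, N)%:R) * `|(B + n%:R) * W n.+1|.
    by rewrite normrM (gtr0_norm BN); ring.
  rewrite W_step normrM (gtr0_norm AN).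
  have -> : n.+1%:R * 'C(n.+1 + N, N)%:R = (n.+1 + N)%:R * 'C(n + N, N)%:R :> R.
    rewrite -!natrM; congr _%:R.
    by have := mul_bin_down (n.+1 + N) N; rewrite addnK addSn.
  have -> : n.+1%:R * ((B + n%:R) * ('C(n + N, N)%:R * `|W n|)) =
      (n.+1%:R * (B + n%:R)) * ('C(n + N, N)%:R * `|W n|) by ring.
  have -> : (n.+1 + N)%:R * 'C(n + N, N)%:R * ((A + n%:R) * `|W n|) =
      ((n.+1 + N)%:R * (A + n%:R)) * ('C(n + N, N)%:R * `|W n|) by ring.
  rewrite ler_wpM2r ?mulr_ge0 ?normr_ge0// natrD -natr1.
  have : B * n%:R <= N%:R * n%:R by rewrite ler_wpM2r.
  have : 0 <= A * n%:R by rewrite mulr_ge0// ltW.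
  move: (n%:R : R) (N%:R : R) NA => u v h1 h2 h3.
  rewrite -subr_ge0.
  have -> : (u + 1 + v) * (A + u) - (u + 1) * (B + u) =
    A + A * u + (v * A - B) + (v * u - B * u) by ring.
  by apply: addr_ge0; [apply: addr_ge0; [apply: addr_ge0|]|]; rewrite ?subr_ge0//; exact: ltW.
have [K1 hK1] := ty N 0; have [K2 hK2] := tz N 0.
have [L1 hL1] := ty 1 1; have [L2 hL2] := tz 1 1.
have g_ge0 n : 0 <= g ^+ n by rewrite exprn_ge0// ltW.
have Xle n : n.+1%:R * X n <= K1 * L2 + L1 * K2.
  have := hK1 n; have := hK2 n; have := hL1 n; have := hL2 n.
  rewrite addn0 !addn1 !bin1 => l2 l1 k2 k1.
  have nonneg (u : nat -> nat -> R) p : (forall p q, 0 < u p q) -> 0 <= g ^+ n * u p n.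
    by move=> u0; rewrite mulr_ge0// ltW.
  rewrite /X /W.
  set a := g ^+ n * y n n in k1 *; set b := g ^+ n * z n.+1 n in l2 *.
  set c := g ^+ n * y n.+1 n in l1 *; set d := g ^+ n * z n n in k2 *.
  have a0 : 0 <= a by exact: nonneg. have b0 : 0 <= b by exact: nonneg.
  have c0 : 0 <= c by exact: nonneg. have d0 : 0 <= d by exact: nonneg.
  have : `|a * b - c * d| <= a * b + c * d.
    by rewrite (le_trans (ler_normB _ _))// !ger0_norm// mulr_ge0.
  move=> /(ler_wpM2l (ler0n R 'C(n + N, N))) /(ler_wpM2l (ler0n R n.+1)) /le_trans; apply.
  have -> : n.+1%:R * ('C(n + N, N)%:R * (a * b + c * d)) =
     'C(n + N, N)%:R * a * (n.+1%:R * b) + n.+1%:R * c * ('C(n + N, N)%:R * d) by ring.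
  by apply: lerD; apply: ler_pM => //; rewrite mulr_ge0.
suff : X 0 <= 0.
  rewrite /X binn mul1r normr_le0 /W expr0 !mul1r subr_eq0 => /eqP; exact.
set M := K1 * L2 + L1 * K2 in Xle.
rewrite leNgt; apply/negP => X0.
have := Xle (Num.truncn (M / X 0)); rewrite leNgt => /negP; apply.
apply: (@lt_le_trans _ _ ((Num.truncn (M / X 0)).+1%:R * X 0)).
  by rewrite -ltr_pdivrMr//; exact: truncnS_gt.
by rewrite ler_wpM2l.
Qed.
End casoratian.

Section proportional.
Context {R : realType}.
Variables (g A B C : R).
Hypotheses (g0 : 0 <= g) (A0 : 0 < A) (B0 : 0 < B) (C0 : 0 < C).

(** The vanishing of the Casoratian removes the one degree of freedom that the
    relations leave when [0 < g]; if [g = 0] they are a first order recursion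
    and leave none.  Then the difference of one solution and a multiple of the
    other has two vanishing initial values. *)
Lemma contiguous_proportional (y z : nat -> nat -> R) :
  contiguous g A B C y -> contiguous g A B C z ->
  (forall p q, 0 < y p q) -> (forall p q, 0 < z p q) ->
  tail_decay g y -> tail_decay g z ->
  exists2 s, 0 < s & forall p, y p 0 = s * z p 0.
Proof.
move=> cy cz y0 z0 ty tz.
exists (y 0 0 / z 0 0); first by rewrite divr_gt0.
set s := y 0 0 / z 0 0.
pose t p q := y p q - s * z p q.
have [y1 y2] := cy; have [z1 z2] := cz.
have t1 p q : t p q = t p q.+1 + g * t p.+1 q.+1.
  by rewrite /t y1 z1; ring.
have t2 p q : C * t p.+1 q = (A + p%:R) * t p q - g * (B + q%:R) * t p.+1 q.+1.
  by rewrite /t mulrBr y2 mulrCA z2; ring.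
have t00 : t 0 0 = 0 by rewrite /t divfK ?subrr// gt_eqF.
have cancel0 (u v : R) : 0 < u -> u * v = 0 -> v = 0.
  by move=> u0 /eqP; rewrite mulf_eq0 gt_eqF//= => /eqP.
have t10 : t 1 0 = 0.
  move: g0; rewrite le_eqVlt => /predU1P[g00|gp].
    by apply: (cancel0 C) => //; rewrite t2 t00 -g00; ring.
  apply: (cancel0 (z 0 0)) => //; rewrite /t mulrBr mulrC.
  have h := casoratian_eq0 gp A0 B0 cy cz y0 z0 ty tz.
  by rewrite -h /s; field; rewrite gt_eqF.
suff H p : t p 0 = 0 /\ t p.+1 0 = 0.
  by move=> p; have [/eqP] := H p; rewrite subr_eq0 => /eqP.
elim: p => [//|p [IH1 IH2]]; split => //.
apply: (cancel0 C) => //; rewrite t2 IH2 mulr0 sub0r addr0.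
move: g0; rewrite le_eqVlt => /predU1P[g00|gp]; first by rewrite -g00 !mul0r oppr0.
have h1 : t p.+1 1 = 0.
  apply: (cancel0 (g * B)); first by rewrite mulr_gt0.
  have := t2 p 0; rewrite IH1 IH2 !mulr0 addr0 sub0r => /esym/eqP.
  by rewrite oppr_eq0 => /eqP.
have h2 : t p.+2 1 = 0.
  by apply: (cancel0 g) => //; have := t1 p.+1 0; rewrite IH2 h1 add0r.
by rewrite h2 mulr0 oppr0.
Qed.
End proportional.

Section moments.
Context {R : realType}.
Local Notation D := (`]0, +oo[%classic : set R).
Variables (s : {measure set R -> \bar R}) (e : R).
Hypothesis e0 : 0 < e.
Hypothesis s_exp : (\int[s]_(x in D) (expR (e * x))%:E < +oo)%E.
Variable g : R.
Hypothesis g0 : 0 <= g.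

(** The moments that satisfy the first contiguity relation whatever the measure
    is. *)
Definition kummer_moment (m : {measure set R -> \bar R}) h p q : R :=
  \int[m]_(x in D) (x ^+ p / (1 + h * x) ^+ q).

Let gx_gt0 x : D x -> 0 < 1 + g * x.
Proof. by rewrite /= in_itv/= andbT => x0; rewrite ltr_pwDl// mulr_ge0// ltW. Qed.

Lemma measurable_kummer_weight p q : measurable_fun D (fun x => x ^+ p / (1 + g * x) ^+ q).
Proof.
apply: (@eq_measurable_fun _ _ R R D
  (fun x : R => x ^+ p * (1 + g * x) `^ (- q%:R)) (fun x : R => x ^+ p / (1 + g * x) ^+ q)).
  move=> x; rewrite inE => /gx_gt0 gx; rewrite powR_invn//; exact: ltW.
apply: measurable_funTS; apply: measurable_funM; first exact: exprn_measurable.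
apply: (measurableT_comp (measurable_powR (- q%:R))).
by apply: measurable_funD => //; exact: measurable_funM.
Qed.

Lemma integrable_exprn p : s.-integrable D (fun x => (x ^+ p)%:E).
Proof.
have := @integrable_exprn_expR R s e e0 s_exp p 0.
rewrite divr_ge0 ?(ltW e0)// => /(_ isT).
by apply: eq_integrable => // x _; rewrite mul0r expR0 mulr1.
Qed.

Lemma integrable_kummer_weight p q :
  s.-integrable D (fun x => (x ^+ p / (1 + g * x) ^+ q)%:E).
Proof.
apply: le_integrable (integrable_exprn p) => //.
  by apply/measurable_EFinP; exact: measurable_kummer_weight.
move=> x Dx; have gx := gx_gt0 Dx.
have x0 : 0 < x by move: Dx; rewrite /= in_itv/= andbT.
have x0' := ltW x0; have gx' := ltW gx.
have n0 : 0 <= x ^+ p by rewrite exprn_ge0.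
have n1 : 0 <= x ^+ p / (1 + g * x) ^+ q by rewrite divr_ge0// exprn_ge0.
rewrite lee_fin (ger0_norm n0) (ger0_norm n1).
by rewrite ler_piMr// invf_le1 ?exprn_gt0// exprn_ege1// lerDl mulr_ge0.
Qed.

Lemma kummer_moment_split p q :
  kummer_moment s g p q = kummer_moment s g p q.+1 + g * kummer_moment s g p.+1 q.+1.
Proof.
rewrite /kummer_moment -RintegralZl//; last exact: integrable_kummer_weight.
rewrite -RintegralD//; last 2 first.
- exact: integrable_kummer_weight.
- exact: (integrableZl _ g (integrable_kummer_weight _ _)).
apply: eq_Rintegral => x; rewrite inE => /gx_gt0 gx.
by rewrite !exprS; field; rewrite expf_neq0 ?gt_eqF.
Qed.

Lemma integrable_affineX p N : s.-integrable D (fun x => (x ^+ p * (1 + g * x) ^+ N)%:E).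
Proof.
elim: N p => [|N IH] p.
  by apply: eq_integrable (integrable_exprn p) => // x _; rewrite mulr1.
have mD : measurable D by [].
have H := integrableD mD (IH p) (integrableZl mD g (IH p.+1)).
apply: eq_integrable H => // x _.
by rewrite /= -EFinM -EFinD !exprS; congr EFin; ring.
Qed.

(** With [u = g x / (1 + g x)], the binomial theorem bounds
    ['C(n + N, N) u ^+ n (1 - u) ^+ N] by 1; so the integrands are dominated by
    [x ^+ i (1 + g x) ^+ N], uniformly in [n]. *)
Lemma kummer_moment_decay N i : exists K, forall n,
  'C(n + N, N)%:R * (g ^+ n * kummer_moment s g (n + i) n) <= K.
Proof.
exists (\int[s]_(x in D) (x ^+ i * (1 + g * x) ^+ N)) => n.
rewrite /kummer_moment -RintegralZl//; last exact: integrable_kummer_weight.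
rewrite -RintegralZl//; last exact: (integrableZl _ (g ^+ n) (integrable_kummer_weight _ _)).
apply: le_Rintegral => //.
- exact: (integrableZl _ _ (integrableZl _ (g ^+ n) (integrable_kummer_weight _ _))).
- exact: integrable_affineX.
move=> x Dx; have gx := gx_gt0 Dx.
have x0 : 0 < x by move: Dx; rewrite /= in_itv/= andbT.
pose u := g * x / (1 + g * x).
have u0 : 0 <= u by rewrite divr_ge0// ?mulr_ge0// ltW.
have u1 : 1 - u = (1 + g * x)^-1 by rewrite /u; field; rewrite gt_eqF.
have u2 : 0 <= 1 - u by rewrite u1 invr_ge0 ltW.
have bin_le : 'C(n + N, N)%:R * (u ^+ n * (1 - u) ^+ N) <= 1.
  have : (u + (1 - u)) ^+ (n + N) = 1 by rewrite addrC subrK expr1n.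
  have NlnN : (N < (n + N).+1)%N by rewrite ltnS leq_addl.
  rewrite exprDn (bigD1 (Ordinal NlnN))//= addnK -mulr_natl => E.
  rewrite -[leRHS]E lerDl sumr_ge0// => j _.
  by rewrite mulrn_wge0// mulr_ge0// exprn_ge0.
have -> : 'C(n + N, N)%:R * (g ^+ n * (x ^+ (n + i) / (1 + g * x) ^+ n)) =
   x ^+ i * (1 + g * x) ^+ N * ('C(n + N, N)%:R * (u ^+ n * (1 - u) ^+ N)).
  rewrite u1 /u exprVn exprMn exprVn exprMn exprD.
  by field; rewrite !expf_neq0// gt_eqF.
by rewrite ler_piMr// mulr_ge0 ?exprn_ge0// ltW.
Qed.

Lemma Rintegral_gt0 (f : R -> R) : (0 < s D)%E ->
  s.-integrable D (EFin \o f) -> (forall x, D x -> 0 < f x) ->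
  0 < \int[s]_(x in D) f x.
Proof.
move=> sD fi f0; rewrite lt_neqAle eq_sym Rintegral_ge0 ?andbT; last by move=> x /f0/ltW.
apply/eqP => h0; have h : (\int[s]_(x in D) (f x)%:E = 0)%E.
  by rewrite -[LHS]fineK; [congr EFin|exact: integrable_fin_num].
have mf := measurable_int _ fi.
have mD : measurable D by [].
have [+ _] := ae_eq_integral_abs s mD mf.
rewrite (_ : (\int[s]_(x in D) `|(EFin \o f) x|)%E = 0%E); last first.
  by rewrite -h; apply: eq_integral => x; rewrite inE => /f0/ltW ?; rewrite /= ger0_norm.
move=> /(_ erefl)[M [mM M0 sM]].
have : (s D <= s M)%E.
  apply: le_measure; rewrite ?inE// => x Dx; apply: sM => /= /(_ Dx)[] /eqP.
  by rewrite gt_eqF// f0.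
by rewrite M0 leNgt sD.
Qed.

Lemma kummer_moment_gt0 p q : (0 < s D)%E -> 0 < kummer_moment s g p q.
Proof.
move=> sD; apply: Rintegral_gt0 => //; first exact: integrable_kummer_weight.
move=> x Dx; have x0 : 0 < x by move: Dx; rewrite /= in_itv/= andbT.
by rewrite divr_gt0 ?exprn_gt0 ?gx_gt0.
Qed.
End moments.

(** * Identifying a measure from contiguous tilted moments *)

Section tilt.
Context {R : realType}.
Local Notation D := (`]0, +oo[%classic : set R).
Local Notation leb := (@lebesgue_measure R).

Lemma measurable_expRN : measurable_fun [set: R] (fun x : R => expR (- x)).
Proof. by apply: measurableT_comp => //; exact: measurable_oppr. Qed.

Lemma expRN_ge0 (x : R) : 0 <= expR (- x).
Proof. exact: expR_ge0. Qed.

(** Tilting by a decreasing exponential gives all moments to any probability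
    measure on the half line. *)
Definition tilt (m : {measure set R -> \bar R}) : {measure set R -> \bar R} :=
  density_measure m measurable_expRN expRN_ge0.

Lemma tilt_exp (m : {measure set R -> \bar R}) e : e <= 1 -> (m D < +oo)%E ->
  (\int[tilt m]_(x in D) (expR (e * x))%:E < +oo)%E.
Proof.
move=> e1 mD; rewrite integral_density//; last first.
  by apply/measurable_EFinP; apply: measurable_funTS; exact: measurableT_comp.
apply: (le_lt_trans _ mD).
have -> : (m D = \int[m]_(x in D) 1)%E by rewrite integral_cst// mul1e.
apply: ge0_le_integral => //.
- apply: emeasurable_funM; apply/measurable_EFinP; apply: measurable_funTS.
    by apply: measurableT_comp => //; exact: measurable_funM.
  exact: measurable_expRN.
- move=> x; rewrite /= in_itv/= andbT => x0.
  rewrite -EFinM lee_fin -expRD -[leRHS]expR0 ler_expR -[X in _ - X]mul1r -mulrBl.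
  by rewrite mulr_le0_ge0 ?subr_le0// ltW.
Qed.

(** Stated for all Borel sets, as it also says that null sets of the tilted
    measure are null for the original one. *)
Lemma tilt_gt0 (m : {measure set R -> \bar R}) S : measurable S ->
  (0 < m S)%E -> (0 < tilt m S)%E.
Proof.
move=> mS m0; rewrite lt_neqAle measure_ge0 andbT; apply/eqP => /esym h.
have mf : measurable_fun S (fun x : R => (expR (- x))%:E).
  by apply/measurable_EFinP/measurable_funTS; exact: measurable_expRN.
have [+ _] := ae_eq_integral_abs m mS mf.
rewrite (_ : (\int[m]_(x in S) `|(expR (- x))%:E|)%E = 0%E); last first.
  by rewrite -h; apply: eq_integral => x _; rewrite /= ger0_norm ?expR_ge0.
move=> /(_ erefl)[M [mM M0 sM]].
have : (m S <= m M)%E.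
  apply: le_measure; rewrite ?inE// => x Sx; apply: sM => /= /(_ Sx)[] /eqP.
  by rewrite gt_eqF// expR_gt0.
by rewrite M0 leNgt m0.
Qed.

End tilt.

(** The Borel sets of the reals are attached to two different displays, one for
    the reals as a real type and one for the carrier of Lebesgue measure.  The
    following copy of Lebesgue measure lives on the first one, where the laws of
    random variables live. *)
Section lebesgue_default_display.
Variable R : realType.
Local Notation leb := (@lebesgue_measure R).
Definition lebesgue_real (A : set R) : \bar R := leb A.
Let l0 : lebesgue_real set0 = 0%E. Proof. exact: measure0 leb. Qed.
Let l1 A : (0 <= lebesgue_real A)%E. Proof. exact: measure_ge0. Qed.
Let l2 : semi_sigma_additive lebesgue_real.
Proof. exact: (@measure_semi_sigma_additive _ _ _ leb). Qed.
HB.instance Definition _ := isMeasure.Build _ R R lebesgue_real l0 l1 l2.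
Lemma integral_lebesgue_real (D : set R) (f : R -> \bar R) : measurable D ->
  measurable_fun D f -> (forall y, D y -> (0 <= f y)%E) ->
  (\int[lebesgue_real]_(x in D) f x = \int[leb]_(x in D) f x)%E.
Proof.
move=> mD mf f0.
have mid : measurable_fun [set: measurableTypeR R] (idfun : measurableTypeR R -> R).
  exact: measurable_id.
have := @ge0_integral_pushforward _ _ (measurableTypeR R) R R idfun mid leb D f mD mf.
apply.
by move=> y; rewrite inE; exact: f0.
Qed.
End lebesgue_default_display.

Section kummer_moments.
Context {R : realType}.
Local Notation D := (`]0, +oo[%classic : set R).
Local Notation leb := (@lebesgue_measure R).
Variables (g A B C s : R).
Hypotheses (g0 : 0 <= g) (A0 : 0 < A) (B0 : 0 < B) (C0 : 0 < C) (s0 : 0 < s).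

Let mk : measurable_fun [set: R] (fun x => s * kummer_fun g A B C x).
Proof. by apply: measurable_funM => //; exact: measurable_kummer_fun. Qed.

Let k0 x : 0 <= s * kummer_fun g A B C x.
Proof. by rewrite mulr_ge0 ?kummer_fun_ge0// ltW. Qed.

Definition kummer_measure : {measure set R -> \bar R} :=
  @density_measure _ R R (@lebesgue_real R) _ mk k0.

Let tilted c x : kummer_fun g A B (C - c) x = expR (c * x) * kummer_fun g A B C x.
Proof.
have [x0|x0] := leP x 0; first by rewrite !kummer_fun_eq0// mulr0.
by rewrite !kummer_funE// mulrCA !mulrA -[_ * _ * expR _]mulrA -expRD; congr (_ * expR _ / _); ring.
Qed.

Lemma integral_kummer_expR (S : set R) c : measurable S ->
  (\int[kummer_measure]_(x in S) (expR (c * x))%:E =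
   s%:E * \int[leb]_(x in S) (kummer_fun g A B (C - c) x)%:E)%E.
Proof.
move=> mS; rewrite integral_density//; last first.
  by apply/measurable_EFinP; apply: measurable_funTS; exact: measurableT_comp.
have mkS : measurable_fun S (fun x => (kummer_fun g A B (C - c) x)%:E).
  by apply/measurable_EFinP/measurable_funTS; exact: measurable_kummer_fun.
have kS0 x : S x -> (0 <= (kummer_fun g A B (C - c) x)%:E)%E.
  by move=> _; rewrite lee_fin kummer_fun_ge0.
rewrite -integral_lebesgue_real// -ge0_integralZl_EFin//; last exact: ltW.
by apply: eq_integral => x _; rewrite tilted -!EFinM; congr EFin; ring.
Qed.

Lemma kummer_exp e : e < C ->
  (\int[kummer_measure]_(x in D) (expR (e * x))%:E < +oo)%E.
Proof.
move=> eC; rewrite integral_kummer_expR// lte_mul_pinfty//; first by rewrite lee_fin ltW.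
apply: le_lt_trans (@kummer_mass_lty R g A B (C - e) g0 A0 _); last by rewrite subr_gt0.
apply: ge0_subset_integral => //.
- by apply/measurable_EFinP/measurable_funTS; exact: measurable_kummer_fun.
- by move=> x _; rewrite lee_fin kummer_fun_ge0.
Qed.

Lemma kummer_measure_moment p q :
  kummer_moment kummer_measure g p q = s * kummer_massR g (A + p%:R) (B + q%:R) C.
Proof.
have Ap : 0 < A + p%:R by rewrite ltr_pwDl.
rewrite /kummer_moment /Rintegral integral_density//; last 2 first.
- by apply/measurable_EFinP; exact: measurable_kummer_weight.
- move=> x; rewrite /= in_itv/= andbT => x0; rewrite lee_fin.
  by rewrite divr_ge0 ?exprn_ge0 ?addr_ge0 ?mulr_ge0//; exact: ltW.
rewrite integral_mkcond.
transitivity (\int[@lebesgue_real R]_x (s * kummer_fun g (A + p%:R) (B + q%:R) C x)).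
  congr fine; apply: eq_integral => x _; rewrite patchE; case: ifPn.
    rewrite inE/= in_itv/= andbT => x0; rewrite kummer_funX// -EFinM; congr EFin; ring.
  rewrite notin_setE/= in_itv/= andbT => /negP; rewrite -leNgt => x0.
  by rewrite kummer_fun_eq0// mulr0.
rewrite /Rintegral integral_lebesgue_real//; first last.
- by move=> y _; rewrite lee_fin mulr_ge0 ?kummer_fun_ge0// ltW.
- by apply/measurable_EFinP/measurable_funM => //; exact: measurable_kummer_fun.
by rewrite -/(Rintegral _ _ _) RintegralZl//; exact: integrable_kummer_fun.
Qed.

Lemma contiguous_kummer_massR :
  contiguous g A B C (fun p q => kummer_massR g (A + p%:R) (B + q%:R) C).
Proof.
split=> p q; have Ap : 0 < A + p%:R by rewrite ltr_pwDl.
  by rewrite kummer_massR_split// -!natr1 !addrA.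
by rewrite -!natr1 !addrA kummer_massR_parts.
Qed.
End kummer_moments.

Section master.
Context {R : realType}.
Local Notation D := (`]0, +oo[%classic : set R).
Local Notation leb := (@lebesgue_measure R).

(** The moments of the tilted measure are proportional to those of a Kummer
    density with rate [C] by uniqueness of contiguous arrays, hence the two
    measures are proportional by moment determinacy; removing the tilt lowers
    the rate by one. *)
Lemma kummer_density_of_contiguous (m : {measure set R -> \bar R}) (g A B C : R) :
  0 <= g -> 0 < A -> 0 < B -> 0 < C ->
  (0 < m D)%E -> (m D < +oo)%E ->
  contiguous g A B C (kummer_moment (tilt m) g) ->
  exists2 s, 0 < s & forall S, measurable S ->
    m (S `&` D) = (s%:E * \int[leb]_(x in S) (kummer_fun g A B (C - 1) x)%:E)%E.
Proof.
move=> g0 A0 B0 C0 mD0 mDoo cm.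
pose e := Num.min 1 (C / 2).
have e0 : 0 < e by rewrite lt_min ltr01 divr_gt0.
have e1 : e <= 1 by rewrite ge_min lexx.
have eC : e < C by rewrite gt_min; apply/orP; right; rewrite ltr_pdivrMr// ltr_pMr// ltr1n.
have t_exp := tilt_exp e1 mDoo.
pose z p q := kummer_massR g (A + p%:R) (B + q%:R) C.
have z0 p q : 0 < z p q by apply: kummer_massR_gt0 => //; rewrite ltr_pwDl.
have [s s0 hs] : exists2 s, 0 < s & forall p, kummer_moment (tilt m) g p 0 = s * z p 0.
  have cz : contiguous g A B C z by exact: contiguous_kummer_massR.
  apply: (contiguous_proportional g0 A0 B0 C0 cm cz) => //.
  - by move=> p q; apply: (kummer_moment_gt0 e0 t_exp g0); exact: tilt_gt0.
  - exact: (kummer_moment_decay e0 t_exp g0).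
  - move=> N i.
    have [K hK] := kummer_moment_decay e0 (kummer_exp B g0 A0 ltr01 eC) g0 N i.
    by exists K => n; have := hK n; rewrite kummer_measure_moment// mul1r.
exists s => // S mS.
have mom0 (M : {measure set R -> \bar R}) n : \int[M]_(x in D) (x ^+ n) = kummer_moment M g n 0.
  by apply: eq_Rintegral => x _; rewrite divr1.
pose K := kummer_measure g A B C s0.
have det := @moment_determinacy R (tilt m) K e e0 t_exp (kummer_exp B g0 A0 s0 eC).
have {}det : forall E, measurable E -> tilt m (E `&` D) = K (E `&` D).
  by apply: det => n; rewrite !mom0 hs kummer_measure_moment.
have mSD : measurable (S `&` D) by apply: measurableI.
have mexp : measurable_fun (S `&` D) (fun x : R => (expR (1 * x))%:E).
  by apply/measurable_EFinP; apply: measurable_funTS; exact: measurableT_comp.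
transitivity (\int[tilt m]_(x in S `&` D) (expR (1 * x))%:E)%E.
  rewrite integral_density//.
  rewrite -[LHS]mul1e -integral_cst//; apply: eq_integral => x _.
  by rewrite -EFinM -expRD mul1r subrr expR0.
transitivity (\int[K]_(x in S `&` D) (expR (1 * x))%:E)%E.
  apply: eq_measure_integral => E mE ED.
  by rewrite -(@setIidl _ E D) ?det// => x /ED[].
rewrite integral_kummer_expR//; congr (_ * _)%E.
rewrite integral_mkcondr; apply: eq_integral => x _; rewrite patchE; case: ifPn => //.
rewrite notin_setE/= in_itv/= andbT => /negP; rewrite -leNgt => x0.
by rewrite kummer_fun_eq0.
Qed.
End master.

(** * Expectations of products of independent variables *)

Section independence.
Context d (T : measurableType d) (R : realType) (P : probability T R).
Variables (X Y : {RV P >-> R}).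
Hypothesis indep : independent_rv P X Y.

Let XY (t : T) : R * R := (X t, Y t).
Let mXY : measurable_fun [set: T] XY.
Proof. exact: measurable_fun_pair. Qed.
HB.instance Definition _ := isMeasurableFun.Build _ _ _ _ XY mXY.

Lemma joint_law (m1 m2 : probability R R) :
  (forall A, measurable A -> P (X @^-1` A) = m1 A) ->
  (forall A, measurable A -> P (Y @^-1` A) = m2 A) ->
  has_joint_law P X Y (m1 \x m2)%E.
Proof.
move=> Xm1 Ym2 S mS.
have := @product_measure_unique _ _ _ _ _ m1 m2 (distribution P XY) _ S mS.
move=> ->//.
move=> A B mA mB; apply: etrans (_ : P (X @^-1` A) * P (Y @^-1` B) = _)%E.
  by rewrite -indep.
by rewrite Xm1// Ym2.
Qed.

Lemma integral_indep (f h : R -> R) :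
  measurable_fun [set: R] f -> measurable_fun [set: R] h ->
  (forall x, 0 <= f x) -> (forall x, 0 <= h x) ->
  (\int[P]_t (f (X t) * h (Y t))%:E =
   \int[distribution P X]_x (f x)%:E * \int[distribution P Y]_y (h y)%:E)%E.
Proof.
move=> mf mh f0 h0.
pose F (z : R * R) : \bar R := (f z.1 * h z.2)%:E.
have mF : measurable_fun [set: R * R] F.
  by apply/measurable_EFinP; apply: measurable_funM; exact: measurableT_comp.
have F0 z : (0 <= F z)%E by rewrite lee_fin mulr_ge0.
transitivity (\int[distribution P XY]_z F z)%E.
  by rewrite (@ge0_integral_distribution _ _ _ _ _ _ XY).
transitivity (\int[(distribution P X \x distribution P Y)%E]_z F z)%E.
  apply: eq_measure_integral => A mA _.
  exact: (@joint_law (distribution P X) (distribution P Y)).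
rewrite fubini_tonelli1//.
transitivity (\int[distribution P X]_x
    ((\int[distribution P Y]_y (h y)%:E) * (f x)%:E))%E.
  apply: eq_integral => x _; rewrite /fubini_F/= muleC -ge0_integralZl_EFin//.
  - by move=> y _; rewrite lee_fin.
  - exact/measurable_EFinP.
rewrite ge0_integralZl//; first by rewrite muleC.
- exact/measurable_EFinP.
- by move=> x _; rewrite lee_fin.
- by apply: integral_ge0 => y _; rewrite lee_fin.
Qed.
End independence.

(** * Divergent Kummer integrals *)

Section kummer_infinite.
Context {R : realType}.
Local Notation leb := (@lebesgue_measure R).

Lemma integral_inv_expR (n : nat) :
  (\int[leb]_(x in `[1%R, expR n.+1%:R]) (x^-1)%:E = (n.+1%:R)%:E :> \bar R)%E.
Proof.
have lt1 : 1 < expR n.+1%:R :> R by rewrite -[ltLHS]expR0 ltr_expR.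
have pos (x : R) : 1 <= x -> 0 < x by exact: lt_le_trans.
have dln (x : R) : 0 < x -> derivable (@ln R) x 1.
  by move=> x0; have [] := is_derive1_ln x0.
have cln (x : R) : 0 < x -> {for x, continuous (@ln R)}.
  by move=> x0; apply: differentiable_continuous; apply/derivable1_diffP; exact: dln.
rewrite (@continuous_FTC2 R (fun x => x^-1) (@ln R))//.
- by rewrite expRK ln1 sube0.
- apply: derivable_within_continuous => x; rewrite in_itv/= => /andP[/pos x0 _].
  by apply: derivableV => //; rewrite gt_eqF.
- split.
  + by move=> x; rewrite in_itv/= => /andP[/ltW/pos x0 _]; exact: dln.
  + by apply: cvg_at_right_filter; exact: cln.
  + by apply: cvg_at_left_filter; apply: cln; exact: expR_gt0.
- move=> x; rewrite in_itv/= => /andP[/ltW/pos x0 _].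
  by rewrite derive1E (@derive_val _ _ _ _ _ _ _ (is_derive1_ln x0)).
Qed.

(** Above 1 the integrand is at least a multiple of [1 / x]. *)
Lemma kummer_mass_pinfty (g a b c : R) : 0 <= g -> 0 <= b -> b <= a -> c <= 0 ->
  kummer_mass g a b c = +oo%E.
Proof.
move=> g0 b0 ba c0.
pose K := ((1 + g) `^ b)^-1.
have K0 : 0 < K by rewrite invr_gt0 powR_gt0// ltr_wpDr.
have kge x : 1 <= x -> K * x^-1 <= kummer_fun g a b c x.
  move=> x1; have x0 : 0 < x by exact: lt_le_trans x1.
  have gx : 0 < 1 + g * x by rewrite ltr_wpDr// mulr_ge0// ltW.
  have e1 : 1 <= expR (- c * x).
    by rewrite -[leLHS]expR0 ler_expR mulr_ge0 ?oppr_ge0// ltW.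
  have e2 : (1 + g * x) `^ b <= (1 + g) `^ b * x `^ b.
    rewrite -powRM ?addr_ge0// ?(ltW x0)//.
    rewrite ge0_ler_powR// ?nnegrE ?mulr_ge0 ?addr_ge0 ?mulr_ge0//; try exact: ltW.
    by rewrite mulrDl mul1r lerD2r.
  have e3 : x^-1 * x `^ b <= x `^ (a - 1).
    rewrite -powR_inv1 ?(ltW x0)// -powRD ?(gt_eqF x0) ?implybT//.
    by rewrite ler_powR// addrC lerD2r.
  rewrite kummer_funE// ler_pdivlMr ?powR_gt0//.
  apply: (@le_trans _ _ (K * x^-1 * ((1 + g) `^ b * x `^ b))).
    by apply: ler_wpM2l => //; apply: mulr_ge0; [exact: ltW|rewrite invr_ge0; exact: ltW].
  have -> : K * x^-1 * ((1 + g) `^ b * x `^ b) = x^-1 * x `^ b.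
    by rewrite /K; field; rewrite (gt_eqF x0) gt_eqF// powR_gt0// ltr_wpDr.
  by rewrite (le_trans e3)// ler_peMr// powR_ge0.
apply/eqP; rewrite -leye_eq leNgt; apply/negP => h.
have fin : kummer_mass g a b c \is a fin_num.
  by rewrite ge0_fin_numE// integral_ge0// => x _; rewrite lee_fin kummer_fun_ge0.
pose M := fine (kummer_mass g a b c) / K.
have mk (S : set R) : measurable_fun S (fun x => (kummer_fun g a b c x)%:E).
  by apply/measurable_EFinP/measurable_funTS; exact: measurable_kummer_fun.
have minv n : measurable_fun (`[1%R, expR n.+1%:R]%classic : set R) (fun x : R => (x^-1)%:E).
  apply/measurable_EFinP.
  apply: (@eq_measurable_fun _ _ R R _ (fun x : R => x `^ (- 1))).
    move=> x; rewrite inE/= in_itv/= => /andP[x1 _].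
    by rewrite powR_inv1// (le_trans _ x1).
  by apply: measurable_funTS; exact: measurable_powR.
have key n : K * n.+1%:R <= fine (kummer_mass g a b c).
  rewrite -lee_fin fineK// EFinM -integral_inv_expR.
  rewrite -ge0_integralZl_EFin//; last 3 first.
  - by move=> x; rewrite /= in_itv/= => /andP[x1 _]; rewrite lee_fin invr_ge0 (le_trans _ x1).
  - exact: minv.
  - exact: ltW.
  apply: (@le_trans _ _ (\int[leb]_(x in `[1%R, expR n.+1%:R]) (kummer_fun g a b c x)%:E)%E).
    apply: ge0_le_integral => //.
    + move=> x; rewrite /= in_itv/= => /andP[x1 _]; rewrite -EFinM lee_fin.
      by rewrite mulr_ge0 ?ltW// invr_gt0 (lt_le_trans _ x1).
    + by apply: emeasurable_funM => //; exact: minv.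
    + exact: mk.
    + by move=> x; rewrite /= in_itv/= => /andP[x1 _]; rewrite -EFinM lee_fin kge.
  apply: ge0_subset_integral => //.
  - exact: mk.
  - by move=> x _; rewrite lee_fin kummer_fun_ge0.
have := key (Num.truncn M); rewrite leNgt => /negP; apply.
by rewrite mulrC -ltr_pdivrMr// truncnS_gt.
Qed.
End kummer_infinite.

(** * Tilted weights along the transformation *)

Section weights.
Context {R : realType}.
Local Notation D := (`]0, +oo[%classic : set R).
Implicit Types (g x : R) (p q : nat).

(** The density of the tilt is included, so that the moments of the tilted law
    become plain expectations; the weight vanishes off the half line. *)
Definition tilted_weight g p q : R -> R :=
  (fun x => x ^+ p / (1 + g * x) ^+ q * expR (- x)) \_ D.

Lemma tilted_weightE g p q x : 0 < x ->
  tilted_weight g p q x = x ^+ p / (1 + g * x) ^+ q * expR (- x).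
Proof. by move=> x0; rewrite /tilted_weight patchE ifT// inE/= in_itv/= x0. Qed.

Lemma tilted_weight_ge0 g p q x : 0 <= g -> 0 <= tilted_weight g p q x.
Proof.
move=> g0; apply: restrict_ge0 => y; rewrite /= in_itv/= andbT => y0.
have y0' := ltW y0.
by rewrite mulr_ge0 ?expR_ge0// divr_ge0 ?exprn_ge0// addr_ge0// mulr_ge0.
Qed.

Lemma tilted_weight_gt0 g p q x : 0 <= g -> 0 < x -> 0 < tilted_weight g p q x.
Proof.
move=> g0 x0; rewrite tilted_weightE// mulr_gt0 ?expR_gt0// divr_gt0 ?exprn_gt0//.
by rewrite ltr_wpDr// mulr_ge0// ltW.
Qed.

Lemma tilted_weightS g p q x : 0 < x -> tilted_weight g p.+1 q x = x * tilted_weight g p q x.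
Proof. by move=> x0; rewrite !tilted_weightE// exprS !mulrA. Qed.

Lemma measurable_tilted_weight g p q : 0 <= g -> measurable_fun [set: R] (tilted_weight g p q).
Proof.
move=> g0; apply/(measurable_restrictT (fun x => x ^+ p / (1 + g * x) ^+ q * expR (- x))) => //.
apply: measurable_funM; first exact: measurable_kummer_weight.
by apply: measurable_funTS; exact: measurable_expRN.
Qed.

Lemma kummer_moment_tilt (m : {measure set R -> \bar R}) g p q : 0 <= g -> (m D < +oo)%E ->
  (kummer_moment (tilt m) g p q)%:E = (\int[m]_x (tilted_weight g p q x)%:E)%E.
Proof.
move=> g0 mD; have t_exp := tilt_exp (lexx 1) mD.
rewrite /kummer_moment /Rintegral fineK; last first.
  by apply: integrable_fin_num => //; exact: (integrable_kummer_weight ltr01 t_exp g0).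
rewrite integral_density//; last 2 first.
- by apply/measurable_EFinP; exact: measurable_kummer_weight.
- move=> x; rewrite /= in_itv/= andbT => x0; rewrite lee_fin.
  by rewrite divr_ge0 ?exprn_ge0 ?addr_ge0 ?mulr_ge0//; exact: ltW.
rewrite integral_mkcond; apply: eq_integral => x _.
by rewrite /tilted_weight !patchE; case: ifP.
Qed.
End weights.

Section almost_everywhere.
Context d (T : measurableType d) (R : realType) (P : probability T R).

Lemma ae_False : ~ (\forall t \ae P, False).
Proof.
move=> [N [mN N0 sN]].
have : P N = 1%E.
  by rewrite (_ : N = setT) ?probability_setT//; apply/seteqP; split => // t _; apply: sN.
by rewrite N0 => /eqP; rewrite eqe eq_sym oner_eq0.
Qed.

Lemma integral_lt_neq (f h : T -> R) :
  measurable_fun [set: T] f -> measurable_fun [set: T] h ->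
  (forall t, 0 <= f t) -> (forall t, 0 <= h t) ->
  (\int[P]_t (f t)%:E < +oo)%E -> (\forall t \ae P, f t < h t) ->
  (\int[P]_t (f t)%:E != \int[P]_t (h t)%:E)%E.
Proof.
move=> mf mh f0 h0 foo fh; apply/negP => /eqP eqfh.
pose k t := Num.max (h t - f t) 0.
have k0 t : 0 <= k t by rewrite le_max lexx orbT.
have mk : measurable_fun [set: T] k.
  by apply: measurable_maxr => //; exact: measurable_funB.
have hE : (\int[P]_t (h t)%:E = \int[P]_t (f t)%:E + \int[P]_t (k t)%:E)%E.
  rewrite -ge0_integralD//; last 4 first.
  - by move=> t _; rewrite lee_fin.
  - exact/measurable_EFinP.
  - by move=> t _; rewrite lee_fin.
  - exact/measurable_EFinP.
  apply: ge0_ae_eq_integral => //.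
  - exact/measurable_EFinP.
  - by apply: emeasurable_funD; exact/measurable_EFinP.
  - by move=> t _; rewrite lee_fin.
  - by move=> t _; rewrite -EFinD lee_fin addr_ge0.
  apply: filterS fh => t ft _; rewrite -EFinD; congr EFin.
  by rewrite /k max_l ?subr_ge0 ?(ltW ft)// addrC subrK.
have ffin : (\int[P]_t (f t)%:E)%E \is a fin_num.
  by rewrite ge0_fin_numE// integral_ge0// => t _; rewrite lee_fin.
have kint : (\int[P]_t (k t)%:E = 0)%E.
  by rewrite -[LHS](addeK _ ffin) [X in (X - _)%E]addeC -hE -eqfh subee.
have mk' : measurable_fun [set: T] (EFin \o k) by exact/measurable_EFinP.
have [+ _] := ae_eq_integral_abs P measurableT mk'.
rewrite (_ : (\int[P]_t `|(EFin \o k) t|)%E = 0%E); last first.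
  by rewrite -kint; apply: eq_integral => t _; rewrite /= ger0_norm.
move=> /(_ erefl) kae; apply: ae_False.
apply: filterS2 fh kae => t ft /(_ I)/= [] /eqP.
by rewrite /k eq_sym lt_eqF// lt_max subr_gt0 ft.
Qed.
End almost_everywhere.

(** The transformation [(x, y) |-> (u, v)] preserves [x + y] and the two ratios
    [x / (1 + be y) = v / (1 + al u)] and [y / (1 + al x) = u / (1 + be v)].
    The product of weights below is a function of these three invariants. *)
Section pointwise.
Context {R : realType}.
Variables (al be x y : R).
Hypotheses (al0 : 0 <= al) (be0 : 0 <= be) (x0 : 0 < x) (y0 : 0 < y).
Let u := y * ((1 + be * (x + y)) / (1 + al * x + be * y)).
Let v := x * ((1 + al * (x + y)) / (1 + al * x + be * y)).

Let ax : 0 < 1 + al * x. Proof. by rewrite ltr_wpDr// mulr_ge0// ltW. Qed.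
Let bey : 0 < 1 + be * y. Proof. by rewrite ltr_wpDr// mulr_ge0// ltW. Qed.
Let D0 : 0 < 1 + al * x + be * y.
Proof. by rewrite ltr_wpDr// mulr_ge0// ltW. Qed.
Let xy0 : 0 < x + y. Proof. exact: addr_gt0. Qed.
Let axy : 0 < 1 + al * (x + y). Proof. by rewrite ltr_wpDr// mulr_ge0// ltW. Qed.
Let bxy : 0 < 1 + be * (x + y). Proof. by rewrite ltr_wpDr// mulr_ge0// ltW. Qed.

Lemma u_gt0 : 0 < u. Proof. by rewrite mulr_gt0// divr_gt0. Qed.
Lemma v_gt0 : 0 < v. Proof. by rewrite mulr_gt0// divr_gt0. Qed.

Lemma uvD : u + v = x + y.
Proof. by rewrite /u /v; field; rewrite gt_eqF. Qed.

Let bv : 1 + be * v = (1 + al * x) * (1 + be * (x + y)) / (1 + al * x + be * y).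
Proof. by rewrite /v; field; rewrite gt_eqF. Qed.
Let au : 1 + al * u = (1 + be * y) * (1 + al * (x + y)) / (1 + al * x + be * y).
Proof. by rewrite /u; field; rewrite gt_eqF. Qed.

Lemma uv_ratio1 : v / (1 + al * u) = x / (1 + be * y).
Proof. by rewrite au /v; field; rewrite !gt_eqF. Qed.
Lemma uv_ratio2 : u / (1 + be * v) = y / (1 + al * x).
Proof. by rewrite bv /u; field; rewrite !gt_eqF. Qed.

Lemma yu_sub : y - u = (al - be) * (x * y / (1 + al * x + be * y)).
Proof. by rewrite /u; field; rewrite gt_eqF. Qed.

Lemma tilted_weight_uv p q :
  tilted_weight al p q x * tilted_weight be q p y =
  tilted_weight be p q v * tilted_weight al q p u.
Proof.
have u0 := u_gt0; have v0 := v_gt0.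
have au0 : 0 < 1 + al * u by rewrite ltr_wpDr// mulr_ge0// ltW.
have bv0 : 0 < 1 + be * v by rewrite ltr_wpDr// mulr_ge0// ltW.
rewrite !tilted_weightE//.
transitivity ((x / (1 + be * y)) ^+ p * (y / (1 + al * x)) ^+ q * expR (- (x + y))).
  rewrite opprD expRD !expr_div_n; field.
  by rewrite !expf_neq0 ?gt_eqF.
rewrite -uv_ratio1 -uv_ratio2 -uvD opprD expRD !expr_div_n; field.
by rewrite !expf_neq0 ?gt_eqF.
Qed.
End pointwise.

(** * Tilted moments of the four variables *)

(** The inverse function is total, with value 0 at 0, and is expressed through
    [powR] on nonnegative reals. *)
Lemma measurable_invr (R : realType) : measurable_fun [set: R] (@GRing.inv R).
Proof.
rewrite (_ : GRing.inv = fun x : R => x * (x ^+ 2) `^ (-1)).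
  apply: measurable_funM => //; apply: (measurableT_comp (measurable_powR (-1))).
  exact: exprn_measurable.
apply/funext => x; rewrite powR_inv1 ?sqr_ge0//.
have [->|x0] := eqVneq x 0; first by rewrite invr0 mul0r.
by field.
Qed.

Section tilted_moments.
Context d (T : measurableType d) (R : realType) (P : probability T R).
Local Notation D := (`]0, +oo[%classic : set R).

Lemma distribution_itv0y (Z : {RV P >-> R}) :
  (\forall t \ae P, 0 < Z t) -> distribution P Z D = 1%E.
Proof.
move=> Z0.
have mZ : measurable (Z @^-1` D) by rewrite -[_ @^-1` _]setTI; exact: measurable_funP.
rewrite -(@probability_setT _ _ _ P) /distribution/= /pushforward.
rewrite -[LHS]mul1e -[RHS]mul1e.
rewrite -!integral_cst// integral_mkcond.
apply: ge0_ae_eq_integral => //.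
- by apply/(measurable_restrictT (cst 1%E)).
- by move=> t _; apply: erestrict_ge0.
apply: filterS Z0 => t Zt _; rewrite patchE ifT// inE/= in_itv/= Zt//.
Qed.

Lemma distribution_lty (Z : {RV P >-> R}) : (distribution P Z D < +oo)%E.
Proof. by rewrite (le_lt_trans (probability_le1 _ _))// ltry. Qed.

Definition tilted_moment (Z : {RV P >-> R}) g p q : R :=
  kummer_moment (tilt (distribution P Z)) g p q.

Lemma tilted_moment_gt0 (Z : {RV P >-> R}) g p q :
  (\forall t \ae P, 0 < Z t) -> 0 <= g -> 0 < tilted_moment Z g p q.
Proof.
move=> Z0 g0; apply: (kummer_moment_gt0 ltr01 (tilt_exp (lexx 1) (distribution_lty Z)) g0).
by apply: tilt_gt0 => //; exact: (eq_ind_r (fun z => 0 < z)%E lte01 (distribution_itv0y Z0)).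
Qed.

Lemma tilted_moment_split (Z : {RV P >-> R}) g p q : 0 <= g ->
  tilted_moment Z g p q =
  tilted_moment Z g p q.+1 + g * tilted_moment Z g p.+1 q.+1.
Proof.
move=> g0; apply: (kummer_moment_split ltr01 _ g0).
exact: (tilt_exp (lexx 1) (distribution_lty Z)).
Qed.

End tilted_moments.

Section core.
Context d (T : measurableType d) (R : realType) (P : probability T R).
Local Notation D := (`]0, +oo[%classic : set R).
Variables (al be : R) (X Y U V : {RV P >-> R}).
Hypotheses (al0 : 0 <= al) (be0 : 0 <= be) (albe : al != be).
Hypotheses (X0 : \forall t \ae P, 0 < X t) (Y0 : \forall t \ae P, 0 < Y t).
Hypotheses (indXY : independent_rv P X Y) (indUV : independent_rv P U V).
Hypothesis UE : forall t, U t = Y t * ((1 + be * (X t + Y t)) / (1 + al * X t + be * Y t)).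
Hypothesis VE : forall t, V t = X t * ((1 + al * (X t + Y t)) / (1 + al * X t + be * Y t)).

Let XY0 : \forall t \ae P, 0 < X t /\ 0 < Y t.
Proof. by apply: filterS2 X0 Y0. Qed.

Let U0 : \forall t \ae P, 0 < U t.
Proof. by apply: filterS XY0 => t [x0 y0]; rewrite UE; exact: u_gt0. Qed.
Let V0 : \forall t \ae P, 0 < V t.
Proof. by apply: filterS XY0 => t [x0 y0]; rewrite VE; exact: v_gt0. Qed.

Let a p q := tilted_moment X al p q.
Let b p q := tilted_moment Y be q p.
Let c p q := tilted_moment V be p q.
Let d' p q := tilted_moment U al q p.

Let MM (Z W : {RV P >-> R}) g g' p q p' q' : independent_rv P Z W -> 0 <= g -> 0 <= g' ->
  (tilted_moment Z g p q * tilted_moment W g' p' q')%:E =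
  (\int[P]_t (tilted_weight g p q (Z t) * tilted_weight g' p' q' (W t))%:E)%E.
Proof.
move=> ind g0 g'0; rewrite EFinM !kummer_moment_tilt ?distribution_lty// integral_indep//.
- exact: measurable_tilted_weight.
- exact: measurable_tilted_weight.
- by move=> x; exact: tilted_weight_ge0.
- by move=> x; exact: tilted_weight_ge0.
Qed.

Let mprod (Z W : {RV P >-> R}) g g' p q p' q' : 0 <= g -> 0 <= g' ->
  measurable_fun [set: T] (fun t => (tilted_weight g p q (Z t) * tilted_weight g' p' q' (W t))%:E).
Proof.
move=> g0 g'0; apply/measurable_EFinP; apply: measurable_funM.
  by apply: measurableT_comp => //; exact: measurable_tilted_weight.
by apply: measurableT_comp => //; exact: measurable_tilted_weight.
Qed.

Let prod0 (Z W : {RV P >-> R}) g g' p q p' q' t : 0 <= g -> 0 <= g' ->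
  0 <= tilted_weight g p q (Z t) * tilted_weight g' p' q' (W t).
Proof. by move=> g0 g'0; rewrite mulr_ge0 ?tilted_weight_ge0. Qed.

Let indVU : independent_rv P V U.
Proof. by move=> A B mA mB; rewrite setIC indUV// muleC. Qed.

Let abcd p q : a p q * b p q = c p q * d' p q.
Proof.
apply: EFin_inj; rewrite !MM//; apply: ge0_ae_eq_integral => //.
- exact: mprod.
- exact: mprod.
- by move=> t _; rewrite lee_fin prod0.
- by move=> t _; rewrite lee_fin prod0.
by apply: filterS XY0 => t [x0 y0] _; rewrite UE VE tilted_weight_uv.
Qed.

Let MMD (Z W : {RV P >-> R}) g g' p q : independent_rv P Z W -> 0 <= g -> 0 <= g' ->
  (tilted_moment Z g p.+1 q * tilted_moment W g' q p +
   tilted_moment Z g p q * tilted_moment W g' q.+1 p)%:E =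
  (\int[P]_t ((tilted_weight g p.+1 q (Z t) * tilted_weight g' q p (W t))%:E +
               (tilted_weight g p q (Z t) * tilted_weight g' q.+1 p (W t))%:E))%E.
Proof.
move=> ind g0 g'0; rewrite EFinD !MM// ge0_integralD//.
- by move=> t _; rewrite lee_fin prod0.
- exact: mprod.
- by move=> t _; rewrite lee_fin prod0.
- exact: mprod.
Qed.

Let abcd_sum p q :
  a p.+1 q * b p q + a p q * b p q.+1 = c p.+1 q * d' p q + c p q * d' p q.+1.
Proof.
apply: EFin_inj; rewrite (MMD p q indXY al0 be0) (MMD p q indVU be0 al0).
apply: ge0_ae_eq_integral => //.
- by apply: emeasurable_funD; exact: mprod.
- by apply: emeasurable_funD; exact: mprod.
- by move=> t _; rewrite -EFinD lee_fin addr_ge0// prod0.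
- by move=> t _; rewrite -EFinD lee_fin addr_ge0// prod0.
apply: filterS XY0 => t [x0 y0] _; rewrite -!EFinD; congr EFin.
have u0 := u_gt0 al0 be0 x0 y0; have v0 := v_gt0 al0 be0 x0 y0.
have S := uvD al0 be0 x0 y0; have W := tilted_weight_uv al0 be0 x0 y0 p q.
rewrite -UE in u0 S W; rewrite -VE in v0 S W; rewrite !tilted_weightS//.
transitivity ((X t + Y t) *
  (tilted_weight al p q (X t) * tilted_weight be q p (Y t))); first by ring.
by rewrite W -S; ring.
Qed.

(** Under the weighted law, the mean of Y differs from that of U because
    [Y - U] has the constant sign of [al - be].  This is where [al != be] is
    used. *)
Let bd_neq p q : b p q.+1 * d' p q != d' p q.+1 * b p q.
Proof.
suff : a p q * b p q.+1 != c p q * d' p q.+1.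
  apply: contraNN => /eqP e.
  have d0 : d' p q != 0 by rewrite gt_eqF// tilted_moment_gt0.
  apply/eqP; apply: (mulIf d0).
  by rewrite -mulrA e [RHS]mulrAC -abcd; ring.
have fin (Z W : {RV P >-> R}) g g' p1 q1 p2 q2 : independent_rv P Z W -> 0 <= g -> 0 <= g' ->
    (\int[P]_t (tilted_weight g p1 q1 (Z t) * tilted_weight g' p2 q2 (W t))%:E < +oo)%E.
  by move=> *; rewrite -MM// ltry.
have mp (Z W : {RV P >-> R}) g g' p1 q1 p2 q2 : 0 <= g -> 0 <= g' ->
  measurable_fun [set: T] (fun t => tilted_weight g p1 q1 (Z t) * tilted_weight g' p2 q2 (W t)).
  by move=> *; apply/measurable_EFinP; exact: mprod.
have key t : 0 < X t -> 0 < Y t -> tilted_weight al p q (X t) * tilted_weight be q.+1 p (Y t) -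
    tilted_weight be p q (V t) * tilted_weight al q.+1 p (U t) =
    (al - be) * (X t * Y t / (1 + al * X t + be * Y t) *
      (tilted_weight al p q (X t) * tilted_weight be q p (Y t))).
  move=> x0 y0.
  have u0 := u_gt0 al0 be0 x0 y0; have v0 := v_gt0 al0 be0 x0 y0.
  have W := tilted_weight_uv al0 be0 x0 y0 p q; have S := yu_sub al0 be0 x0 y0.
  rewrite -UE in u0 S W; rewrite -VE in v0 W; rewrite !tilted_weightS//.
  transitivity ((Y t - U t) * (tilted_weight al p q (X t) * tilted_weight be q p (Y t))).
    by rewrite mulrBl {2}W; ring.
  by rewrite S -!mulrA.
have pos t : 0 < X t -> 0 < Y t ->
    0 < X t * Y t / (1 + al * X t + be * Y t) *
      (tilted_weight al p q (X t) * tilted_weight be q p (Y t)).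
  move=> x0 y0; apply: mulr_gt0; last by rewrite mulr_gt0 ?tilted_weight_gt0.
  rewrite divr_gt0 ?mulr_gt0// -addrA ltr_wpDr// addr_ge0// mulr_ge0//; exact: ltW.
apply/negP => /eqP e0.
have e : (a p q * b p q.+1)%:E = (c p q * d' p q.+1)%:E by rewrite e0.
rewrite !MM// in e.
have [ltab|ltba|eqab] := ltgtP al be; last by move: albe; rewrite eqab eqxx.
- have H : \forall t \ae P, tilted_weight al p q (X t) * tilted_weight be q.+1 p (Y t) <
      tilted_weight be p q (V t) * tilted_weight al q.+1 p (U t).
    apply: filterS XY0 => t [x0 y0].
    by rewrite -subr_lt0 key// nmulr_rlt0 ?subr_lt0// pos.
  have := integral_lt_neq (mp X Y al be p q q.+1 p al0 be0)
    (mp V U be al p q q.+1 p be0 al0) (fun t => prod0 _ _ _ _ _ _ t al0 be0)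
    (fun t => prod0 _ _ _ _ _ _ t be0 al0) (fin _ _ _ _ _ _ _ _ indXY al0 be0) H.
  by rewrite e eqxx.
- have H : \forall t \ae P, tilted_weight be p q (V t) * tilted_weight al q.+1 p (U t) <
      tilted_weight al p q (X t) * tilted_weight be q.+1 p (Y t).
    apply: filterS XY0 => t [x0 y0].
    by rewrite -subr_gt0 key// pmulr_rgt0 ?subr_gt0// pos.
  have := integral_lt_neq (mp V U be al p q q.+1 p be0 al0)
    (mp X Y al be p q q.+1 p al0 be0) (fun t => prod0 _ _ _ _ _ _ t be0 al0)
    (fun t => prod0 _ _ _ _ _ _ t al0 be0) (fin _ _ _ _ _ _ _ _ indVU be0 al0) H.
  by rewrite e eqxx.
Qed.

Lemma tilted_factorization : exists k h : nat -> R,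
  [/\ (forall p, 0 < k p) /\ (forall q, 0 < h q),
      forall p q, tilted_moment X al p.+1 q =
        k p * tilted_moment X al p q - al * h q * tilted_moment X al p.+1 q.+1,
      forall p q, tilted_moment Y be q.+1 p =
        h q * tilted_moment Y be q p - be * k p * tilted_moment Y be q.+1 p.+1,
      forall p q, tilted_moment V be p.+1 q =
        k p * tilted_moment V be p q - be * h q * tilted_moment V be p.+1 q.+1 &
      forall p q, tilted_moment U al q.+1 p =
        h q * tilted_moment U al q p - al * k p * tilted_moment U al q.+1 p.+1].
Proof.
apply: (@factorization R al be a b c d').
- by move=> p q; apply: (tilted_moment_gt0 _ _ X0).
- by move=> p q; apply: (tilted_moment_gt0 _ _ U0).
- by move=> p q; apply: (tilted_moment_split X).
- by move=> p q; apply: (tilted_moment_split Y).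
- by move=> p q; apply: (tilted_moment_split V).
- by move=> p q; apply: (tilted_moment_split U).
- exact: abcd.
- exact: abcd_sum.
- exact: bd_neq.
Qed.
End core.

(** * A stationary array forces a constant variable *)

(** If the coefficients [k] and [h] do not depend on the indices, then
    [theta y = y - h + g k y / (1 + g y)] is orthogonal, for the tilted law, to
    all weights, hence to itself.  So [theta] vanishes almost surely, and it is
    injective. *)
Section rigidity.
Context d (T : measurableType d) (R : realType) (P : probability T R).
Local Notation D := (`]0, +oo[%classic : set R).
Variables (g k h : R) (Z : {RV P >-> R}).
Hypotheses (g0 : 0 <= g) (k0 : 0 < k) (Z0 : \forall t \ae P, 0 < Z t).
Hypothesis stationary : forall p q,
  tilted_moment Z g q.+1 p = h * tilted_moment Z g q p - g * k * tilted_moment Z g q.+1 p.+1.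

Let s := tilt (distribution P Z).
Let s_exp := tilt_exp (lexx 1) (distribution_lty Z).
Let w q p (y : R) := y ^+ q / (1 + g * y) ^+ p.
Let theta y := w 1 0 y - h * w 0 0 y + g * k * w 1 1 y.

Let wi q p : s.-integrable D (EFin \o w q p).
Proof. exact: (integrable_kummer_weight ltr01 s_exp g0). Qed.

Let comb_int (c1 c2 c3 : R) (f1 f2 f3 : R -> R) :
  s.-integrable D (EFin \o f1) -> s.-integrable D (EFin \o f2) ->
  s.-integrable D (EFin \o f3) ->
  s.-integrable D (fun x => (c1 * f1 x + c2 * f2 x + c3 * f3 x)%:E) /\
  \int[s]_(x in D) (c1 * f1 x + c2 * f2 x + c3 * f3 x) =
  c1 * \int[s]_(x in D) f1 x + c2 * \int[s]_(x in D) f2 x + c3 * \int[s]_(x in D) f3 x.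
Proof.
move=> i1 i2 i3; have mD : measurable D by [].
have j1 := integrableZl mD c1 i1; have j2 := integrableZl mD c2 i2.
have j3 := integrableZl mD c3 i3; have j12 := integrableD mD j1 j2.
split; first exact: (integrableD mD j12 j3).
rewrite (RintegralD mD j12 j3).
by rewrite (RintegralD mD j1 j2) !RintegralZl.
Qed.

Let integral_theta_weight q p : s.-integrable D (EFin \o (fun y => theta y * w q p y)) /\
  \int[s]_(y in D) (theta y * w q p y) = 0.
Proof.
have [i e] := comb_int 1 (- h) (g * k) (wi q.+1 p) (wi q p) (wi q.+1 p.+1).
have E x : D x -> 1 * w q.+1 p x + - h * w q p x + g * k * w q.+1 p.+1 x = theta x * w q p x.
  rewrite /= in_itv/= andbT => x0; have gx : 0 < 1 + g * x by rewrite ltr_wpDr// mulr_ge0// ltW.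
  by rewrite /theta /w !exprS expr0; field; rewrite ?expf_neq0 ?gt_eqF.
split.
  by apply: eq_integrable i => // x; rewrite inE => Dx; rewrite /= E.
transitivity (\int[s]_(x in D) (1 * w q.+1 p x + - h * w q p x + g * k * w q.+1 p.+1 x)).
  by apply: eq_Rintegral => x; rewrite inE => Dx; rewrite E.
have st : \int[s]_(x in D) w q.+1 p x = h * \int[s]_(x in D) w q p x -
  g * k * \int[s]_(x in D) w q.+1 p.+1 x := stationary p q.
by rewrite e st; ring.
Qed.

Let integral_theta_sq : \int[s]_(y in D) (theta y * theta y) = 0 /\
  s.-integrable D (fun y => (theta y * theta y)%:E).
Proof.
have [i10 e10] := integral_theta_weight 1 0.
have [i00 e00] := integral_theta_weight 0 0.
have [i11 e11] := integral_theta_weight 1 1.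
have [i e] := comb_int 1 (- h) (g * k) i10 i00 i11.
have E x : 1 * (theta x * w 1 0 x) + - h * (theta x * w 0 0 x) +
    g * k * (theta x * w 1 1 x) = theta x * theta x.
  by rewrite /theta; ring.
split.
  transitivity (\int[s]_(x in D) (1 * (theta x * w 1 0 x) +
      - h * (theta x * w 0 0 x) + g * k * (theta x * w 1 1 x))).
    by apply: eq_Rintegral => x _; rewrite E.
  by rewrite e e10 e00 e11 !mulr0 !addr0.
by apply: eq_integrable i => // x _; rewrite E.
Qed.

Let theta_inj x y : D x -> D y -> theta x = theta y -> x = y.
Proof.
rewrite /= !in_itv/= !andbT => x0 y0.
have gx : 0 < 1 + g * x by rewrite ltr_wpDr// mulr_ge0// ltW.
have gy : 0 < 1 + g * y by rewrite ltr_wpDr// mulr_ge0// ltW.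
move=> /eqP; rewrite -subr_eq0.
have -> : theta x - theta y = (x - y) * (1 + g * k / ((1 + g * x) * (1 + g * y))).
  by rewrite /theta /w !expr1 !expr0; field; rewrite !gt_eqF.
rewrite mulf_eq0 => /orP[|]; first by rewrite subr_eq0 => /eqP.
by rewrite gt_eqF// ltr_pwDl// divr_ge0// mulr_ge0// ltW.
Qed.

Lemma dirac_of_stationary : dirac_rv P Z.
Proof.
have [e i] := integral_theta_sq.
pose N := D `&` theta @^-1` (~` [set 0]).
have mtheta : measurable_fun D theta.
  apply: measurable_funD; first apply: measurable_funB.
  - exact: measurable_kummer_weight.
  - by apply: measurable_funM => //; exact: measurable_kummer_weight.
  - by apply: measurable_funM => //; exact: measurable_kummer_weight.
have mD : measurable D by [].
have mN : measurable N by apply: mtheta => //; exact: measurableC.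
have sN : s N = 0%E.
  have mf := measurable_int _ i.
  have [+ _] := ae_eq_integral_abs s mD mf.
  rewrite (_ : (\int[s]_(y in D) `|(theta y * theta y)%:E|)%E = 0%E); last first.
    rewrite -[RHS](congr1 EFin e) /Rintegral fineK; last exact: integrable_fin_num.
    by apply: eq_integral => y _; rewrite /= ger0_norm// -expr2 sqr_ge0.
  move=> /(_ erefl)[M [mM M0 sM]].
  apply/eqP; rewrite -measure_le0 -M0; apply: le_measure; rewrite ?inE// => y [Dy thy].
  apply: sM => /= /(_ Dy)[] /eqP; rewrite mulf_eq0 orbb => /eqP.
  exact: thy.
have PN : P (Z @^-1` N) = 0%E.
  apply/eqP; rewrite -measure_le0 leNgt; apply/negP => h0.
  have := @tilt_gt0 _ (distribution P Z) N mN h0.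
  by rewrite -/s sN ltxx.
have Nae : \forall t \ae P, ~ N (Z t).
  exists (Z @^-1` N); split => //.
    by rewrite -[_ @^-1` _]setTI; exact: measurable_funP.
  by move=> t /= /contrapT.
have [[k1 [Dk1 thk1]]|nok] := pselect (exists k1, D k1 /\ theta k1 = 0).
  exists k1; apply: filterS2 Z0 Nae => t Zt nN.
  have Dt : D (Z t) by rewrite /= in_itv/= Zt.
  apply: theta_inj => //; rewrite thk1; by apply: contrapT => nz; apply: nN; split.
exists 0; apply: filterS2 Z0 Nae => t Zt nN; exfalso; apply: nok; exists (Z t).
have Dt : D (Z t) by rewrite /= in_itv/= Zt.
by split => //; apply: contrapT => nz; apply: nN; split.
Qed.
End rigidity.

(** * Kummer laws *)

(** The tilted moments determine the law up to a factor, which is fixed by the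
    total mass; in particular that mass is finite. *)
Section identification.
Context d (T : measurableType d) (R : realType) (P : probability T R).
Local Notation D := (`]0, +oo[%classic : set R).
Local Notation leb := (@lebesgue_measure R).
Variables (Z : {RV P >-> R}) (g A B C : R).
Hypotheses (g0 : 0 <= g) (A0 : 0 < A) (B0 : 0 < B) (C0 : 0 < C).
Hypothesis Z0 : \forall t \ae P, 0 < Z t.
Hypothesis Zc : contiguous g A B C (tilted_moment Z g).

Let law : exists2 s, 0 < s & forall S, measurable S ->
  P (Z @^-1` S) = (s%:E * \int[leb]_(x in S) (kummer_fun g A B (C - 1) x)%:E)%E.
Proof.
have D1 := distribution_itv0y Z0.
have [|s s0 hs] := kummer_density_of_contiguous g0 A0 B0 C0 _ (distribution_lty Z) Zc.
  exact: (eq_ind_r (fun z => 0 < z)%E lte01 D1).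
exists s => // S mS; rewrite -hs//.
have mZS (E : set R) : measurable E -> measurable (Z @^-1` E).
  by move=> mE; rewrite -[_ @^-1` _]setTI; exact: measurable_funP.
have mDc : measurable (~` D) by exact: measurableC.
have PDc : P (Z @^-1` (~` D)) = 0%E.
  rewrite preimage_setC probability_setC; last by apply: (mZS D); exact: measurable_itv.
  by have -> : P (Z @^-1` D) = 1%E := D1; rewrite subee.
rewrite /distribution /pushforward.
rewrite -[in LHS](setIT S) -(setUv D) setIUr preimage_setU measureU; last 3 first.
- by apply: mZS; exact: measurableI.
- by apply: mZS; exact: measurableI.
- by rewrite -preimage_setI setIACA setICr setI0 preimage_set0.
rewrite [X in (_ + X)%E](_ : _ = 0%E) ?adde0//.
apply/eqP; rewrite -measure_le0 -[leRHS]PDc.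
apply: le_measure; rewrite ?inE; first by apply: mZS; exact: measurableI.
  exact: mZS.
by move=> t [].
Qed.

Lemma kummer_mass_lty_of_contiguous : (kummer_mass g A B (C - 1) < +oo)%E.
Proof.
have [s s0 hs] := law; have := hs _ measurableT.
rewrite preimage_setT probability_setT => h.
rewrite ltNge leye_eq; apply/negP => /eqP mass.
by move: h; rewrite -/(kummer_mass g A B (C - 1)) mass gt0_muley ?lte_fin.
Qed.

Lemma law_eq_kummer S : 0 < C - 1 -> measurable S ->
  P (Z @^-1` S) = kummer_prob g A B (C - 1) S.
Proof.
move=> c0 mS; have [s s0 hs] := law; have := hs _ measurableT.
rewrite preimage_setT probability_setT -/(kummer_mass g A B (C - 1)) => h.
have mfin : kummer_mass g A B (C - 1) = (s^-1)%:E.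
  have fin : kummer_mass g A B (C - 1) \is a fin_num.
    by rewrite ge0_fin_numE ?kummer_mass_lty_of_contiguous// ltW// kummer_mass_gt0.
  rewrite -(fineK fin); congr EFin; apply: (mulfI (lt0r_neq0 s0)).
  by rewrite divff ?gt_eqF//; apply: EFin_inj; rewrite EFinM fineK// -h.
rewrite hs// /kummer_prob /kummer_pdf mfin/= invrK.
under [RHS]eq_integral do rewrite mulrC EFinM.
rewrite ge0_integralZl_EFin//.
- by move=> x _; rewrite lee_fin kummer_fun_ge0.
- by apply/measurable_EFinP/measurable_funTS; exact: measurable_kummer_fun.
- exact: ltW.
Qed.
End identification.

Theorem theorem4p3 (R : realType) (d : measure_display) (T : measurableType d)
    (P : probability T R) (alpha beta : R) (X Y : {RV P >-> R}) :
  0 <= alpha -> 0 <= beta -> alpha <> beta ->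
  (\forall t \ae P, 0 < X t) -> (\forall t \ae P, 0 < Y t) ->
  independent_rv P X Y ->
  ~ dirac_rv P X -> ~ dirac_rv P Y ->
  let U := fun t : T =>
    Y t * ((1 + beta * (X t + Y t)) / (1 + alpha * X t + beta * Y t)) in
  let V := fun t : T =>
    X t * ((1 + alpha * (X t + Y t)) / (1 + alpha * X t + beta * Y t)) in
  independent_rv P U V ->
  exists a b c : R, [/\ 0 < a, 0 < b & 0 < c] /\
    has_joint_law P X Y
      (kummer_prob alpha a b c \x kummer_prob beta b a c)%E /\
    has_joint_law P U V
      (kummer_prob alpha b a c \x kummer_prob beta a b c)%E.
Proof.
move=> al0 be0 /eqP albe X0 Y0 indXY _ Ynd U V indUV.
have mXY (r s : R) : measurable_fun [set: T] (fun t => 1 + r * X t + s * Y t).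
  apply: measurable_funD; first apply: measurable_funD => //.
    exact: measurable_funM.
  exact: measurable_funM.
have mU : measurable_fun [set: T] U.
  apply: measurable_funM => //; apply: measurable_funM.
    apply: measurable_funD => //; apply: measurable_funM => //; exact: measurable_funD.
  by apply: (measurableT_comp (@measurable_invr R)).
have mV : measurable_fun [set: T] V.
  apply: measurable_funM => //; apply: measurable_funM.
    apply: measurable_funD => //; apply: measurable_funM => //; exact: measurable_funD.
  by apply: (measurableT_comp (@measurable_invr R)).
pose Um := isMeasurableFun.Build _ _ _ _ U mU.
pose Vm := isMeasurableFun.Build _ _ _ _ V mV.
pose Urv : {RV P >-> R} := HB.pack U Um.
pose Vrv : {RV P >-> R} := HB.pack V Vm.
have UE t : Urv t = Y t * ((1 + beta * (X t + Y t)) / (1 + alpha * X t + beta * Y t)) by [].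
have VE t : Vrv t = X t * ((1 + alpha * (X t + Y t)) / (1 + alpha * X t + beta * Y t)) by [].
have U0 : \forall t \ae P, 0 < Urv t.
  by apply: filterS2 X0 Y0 => t x0 y0; rewrite UE; exact: u_gt0.
have V0 : \forall t \ae P, 0 < Vrv t.
  by apply: filterS2 X0 Y0 => t x0 y0; rewrite VE; exact: v_gt0.
have [k [h [[k0 h0] eX eY eV eU]]] :=
  @tilted_factorization _ _ _ P alpha beta X Y Urv Vrv al0 be0 albe X0 Y0 indXY indUV UE VE.
have slopes p q : h q.+1 - h q = k p.+1 - k p.
  have [aE|an0] := eqVneq alpha 0; last first.
    apply: (@shared_slope R alpha (fun p q => tilted_moment Urv alpha q p)) => //.
    - by move=> p' q'; rewrite gt_eqF// tilted_moment_gt0.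
    - by move=> p' q'; exact: tilted_moment_split.
  have bn0 : beta != 0 by rewrite -aE eq_sym.
  apply: (@shared_slope R beta (fun p q => tilted_moment Y beta q p)) => //.
  - by move=> p' q'; rewrite gt_eqF// tilted_moment_gt0.
  - by move=> p' q'; exact: tilted_moment_split.
pose slope := k 1 - k 0.
have kE := @affine_of_slope R k slope (fun p => etrans (esym (slopes p 0)) (slopes 0 0)).
have hE := @affine_of_slope R h slope (fun q => slopes 0 q).
have slope_gt0 : 0 < slope.
  rewrite lt_neqAle (pos_affine_slope k0 kE) andbT; apply/eqP => slope_gt0; apply: Ynd.
  have kc p : k p = k 0 by rewrite kE -slope_gt0 mul0r addr0.
  have hc q : h q = h 0 by rewrite hE -slope_gt0 mul0r addr0.
  apply: (@dirac_of_stationary _ _ _ P beta (k 0) (h 0)) => // p q.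
  by rewrite eY kc hc.
(* [k] and [h] are affine with the same slope, and the parameters are read off
   from [k p = (A + p) / C] and [h q = (B + q) / C] *)
pose C := slope^-1; pose A := k 0 * C; pose B := h 0 * C.
have C0 : 0 < C by rewrite invr_gt0.
have A0 : 0 < A by rewrite mulr_gt0.
have B0 : 0 < B by rewrite mulr_gt0.
have Cd : C * slope = 1 by rewrite mulVf// gt_eqF.
have kA p : C * k p = A + p%:R.
  by rewrite kE mulrDr mulrA Cd mul1r [C * _]mulrC.
have hB q : C * h q = B + q%:R.
  by rewrite hE mulrDr mulrA Cd mul1r [C * _]mulrC.
have cX : contiguous alpha A B C (tilted_moment X alpha).
  split=> p q; first exact: tilted_moment_split.
  by rewrite eX -kA -hB; ring.
have cY : contiguous beta B A C (tilted_moment Y beta).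
  split=> q p; first exact: tilted_moment_split.
  by rewrite eY -kA -hB; ring.
have cV : contiguous beta A B C (tilted_moment Vrv beta).
  split=> p q; first exact: tilted_moment_split.
  by rewrite eV -kA -hB; ring.
have cU : contiguous alpha B A C (tilted_moment Urv alpha).
  split=> q p; first exact: tilted_moment_split.
  by rewrite eU -kA -hB; ring.
have massX := kummer_mass_lty_of_contiguous al0 A0 B0 C0 X0 cX.
have massY := kummer_mass_lty_of_contiguous be0 B0 A0 C0 Y0 cY.
(* otherwise the density of X (if [B <= A]) or of Y (if [A <= B]) would not be
   integrable at infinity *)
have c0 : 0 < C - 1.
  rewrite ltNge; apply/negP => cle.
  have [AB|/ltW BA] := leP A B.
    by move: massY; rewrite kummer_mass_pinfty// ltW.
  by move: massX; rewrite kummer_mass_pinfty// ltW.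
exists A, B, (C - 1); split => //; split.
- apply: (@joint_law _ _ _ P X Y indXY
    (kummer_prob alpha A B (C - 1)) (kummer_prob beta B A (C - 1))).
  + by move=> S mS; exact: law_eq_kummer.
  + by move=> S mS; exact: law_eq_kummer.
- apply: (@joint_law _ _ _ P Urv Vrv indUV
    (kummer_prob alpha B A (C - 1)) (kummer_prob beta A B (C - 1))).
  + by move=> S mS; apply: (law_eq_kummer (Z := Urv)).
  + by move=> S mS; apply: (law_eq_kummer (Z := Vrv)).
Qed.
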